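(* Let $k\geq 19$ be an integer and let $G$ be a graph of order at least $n_k=2^{32k^3}$ and average degree at least $(k+2)(k+1)$. Then $G$ contains $k$ vertex-disjoint cycles of consecutive even lengths.
   Context: All graphs are finite and simple. A collection of $k$ cycles has consecutive even lengths if their lengths are $2r, 2r+2, \dots, 2r+2k-2$ for some integer $r\geq 2$. *)

(* Defs.v *)
From mathcomp Require Import all_boot all_order all_algebra.

Set Implicit Arguments.
Unset Strict Implicit.
Unset Printing Implicit Defensive.

(* A finite simple graph is a symmetric irreflexive [E : rel V], [V : finType]. *)

Definition degree (V : finType) (E : rel V) (x : V) : nat := #|[set y | E x y]|.

Definition avg_degree (V : finType) (E : rel V) : rat :=
  ((\sum_(x : V) degree E x)%N%:R / #|V|%:R)%R.

(* [c] lists the vertices of a cycle in cyclic order, so its length is [size c].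
   The bound on the size is needed because [ucycleb] also accepts the empty
   sequence and an edge traversed back and forth. *)
Definition graph_cycle (V : finType) (E : rel V) (c : seq V) : bool :=
  (2 < size c) && ucycleb E c.

Definition vertex_disjoint (V : finType) (k : nat) (C : 'I_k -> seq V) : Prop :=
  forall i j : 'I_k, i != j -> [disjoint C i & C j].

(* The cycles are indexed by increasing length: 2r, 2r+2, ..., 2r+2k-2. *)
Definition consecutive_even_lengths
    (V : finType) (k : nat) (C : 'I_k -> seq V) : Prop :=
  exists2 r : nat, 2 <= r & forall i : 'I_k, size (C i) = 2 * r + 2 * i.

(* Main.v *)
Require Import Defs.
From mathcomp Require Import all_boot all_order all_algebra.
From mathcomp Require Import zify.

Set Implicit Arguments.
Unset Strict Implicit.
Unset Printing Implicit Defensive.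

Import Order.TTheory GRing.Theory Num.Theory.

(** Let [q = k(k+3)/2], so that [2q+2 = (k+2)(k+1)], [S] is the set of the few
    vertices deleted below and [T] is a subset of [S] with many common neighbours.
    A cycle alternating between [T] and its common neighbours with length [2j]
    uses [j] vertices of [T]; the lengths [4, 6, ..., 2k+2] together cost [q].

    A subgraph [X] with more than [9k|X|/2] edges contains cycles of [k] consecutive
    even lengths [2r, ...] with [r] logarithmic in the order. Hence either greedy
    selection produces disjoint ones, or deleting a polylogarithmic set, together
    with the vertices of very large degree, leaves a graph all of whose subgraphs
    [X] have at most [9k|X|/2] edges. Let [S] be the deleted set and [B] a set of
    remaining vertices maximising the number of edges of the graph on [S] and [B]
    that meet [B], minus [(q + 1/2)|B|]. Apart from a negligible set, the
    neighbourhood in [S] of each vertex is popular, i.e. has many common neighbours.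
    If the largest popular set [T0] has [q - d] elements, then optimality of [B]
    forces the graph induced by [B] to be so dense that it contains many disjoint
    paths of certain lengths [m] whose ends have many neighbours in a bounded subset
    [K] of [S]. Two such paths are closed to a cycle of length [2(m+2)] through only
    two vertices of [S], which saves [m] of them. The total saving is at least [d],
    and [T0] accommodates all the remaining cycles. *)

(** * Reflections of periodic colourings *)

Section Periodic.
Variable f : nat -> bool.

Definition periodic d := forall x, f (x + d) = f x.

Lemma periodicM d a : periodic d -> periodic (a * d).
Proof.
move=> fd; elim: a => [|a IHa] x; first by rewrite mul0n addn0.
by rewrite mulSnr addnA fd IHa.
Qed.

Lemma periodic_eq d a b x y :
  periodic d -> x + a * d = y + b * d -> f x = f y.
Proof.
move=> fd e; have := periodicM a fd x; rewrite e => <-.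
exact: periodicM.
Qed.

Lemma periodic_gcd a b : 0 < a -> periodic a -> periodic b -> periodic (gcdn a b).
Proof.
move=> a_gt0 fa fb x; case: (egcdnP b a_gt0) => km kn e _.
rewrite -(periodicM km fa x) e addnA addnAC.
exact/esym/periodicM.
Qed.

(** Modulo [d] the two identities read [f (- y) = f (rho + 1 + y)] and [f y = f (rho - y)]; their
    composition shifts the argument by one. Together with [d <= sigma] and [sigma + d <= nu], the
    bounds on [rho] make each admissible range of [y] meet every residue class modulo [d]. *)
Lemma reflections_constant (nu rho sigma d : nat) :
    0 < d -> d %| nu -> d %| sigma -> periodic d ->
    0 < sigma < nu -> d <= rho -> d + rho < nu ->
    (forall y, y + rho < nu -> y < sigma -> sigma <= y + rho ->
       f (nu - y) = f (rho + 1 + y - sigma)) ->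
    (forall y, y <= rho -> y < sigma -> sigma + rho < nu + y ->
       f y = f (rho + sigma - y)) ->
  forall x, f x.+1 = f x.
Proof.
move=> d_gt0 /dvdnP[c eN] /dvdnP[e eS] fd /andP[s_gt0 s_lt] d_le_rho d_rho f2 f3 x.
have d_le_s : d <= sigma by rewrite eS leq_pmull //; case: e eS s_gt0 => //; lia.
have sd_le : sigma + d <= nu.
  rewrite eN eS -mulSnr leq_mul2r; apply/orP; right.
  by move: s_lt; rewrite eN eS ltn_mul2r => /andP[].
(* Any [d] consecutive integers contain a representative of [z]; congruence is stated by adding
   multiples of [d] on both sides. *)
have choose lo z : exists2 y, lo <= y < lo + d & exists a b, y + a * d = z + b * d.
  exists (lo + (z + (lo * d - lo)) %% d).
    by rewrite leq_addr ltn_add2l ltn_mod.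
  have := divn_eq (z + (lo * d - lo)) d.
  set w := _ %% d; set v := _ %/ d => ez.
  exists v, lo.
  have : lo <= lo * d by rewrite leq_pmulr.
  lia.
(* [x.+1 * d - x.+1] represents [- x.+1] modulo [d]. *)
have [y /andP[y1 y2] [a [b ey]]] := choose (sigma - rho) (x.+1 * d - x.+1).
have xd : x.+1 <= x.+1 * d by rewrite leq_pmulr.
have [y' /andP[y1' y2'] [a' [b' ey']]] := choose (sigma + rho + 1 - nu) (rho + 1 + y).
have -> : f x.+1 = f (nu - y).
  apply: (@periodic_eq d (a + c) (b + x.+1)) => //; rewrite !mulnDl -eN; lia.
rewrite f2; try lia.
have -> : f (rho + 1 + y - sigma) = f y'.
  apply: (@periodic_eq d (e + b') a') => //; rewrite !mulnDl -eS; lia.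
rewrite f3; try lia.
apply: (@periodic_eq d (b + b' + x.+1) (a + a' + e)) => //.
rewrite !mulnDl -eS; lia.
Qed.

End Periodic.

(** * Paths in a cycle with a chord *)

Section ThetaPaths.
Variables (V : finType) (E : rel V) (Esym : symmetric E).
Variables (c : nat -> V) (nu rho : nat).
Hypothesis c_per : forall x, c (x + 2 * nu) = c x.
Hypothesis c_inj : forall x y, x < 2 * nu -> y < 2 * nu -> c x = c y -> x = y.
Hypothesis c_edge : forall x, E (c x) (c x.+1).
Hypothesis c_chord : E (c 0) (c (2 * rho + 1)).
Hypothesis rho_gt0 : 0 < rho.
Hypothesis rho_lt : rho.+1 < nu.

(** Walks may pass the index [2 * nu], so injectivity is needed on every window of that length. *)
Lemma c_inj_window a x y :
  a <= x < a + 2 * nu -> a <= y < a + 2 * nu -> c x = c y -> x = y.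
Proof.
have cmod z : c z = c (z %% (2 * nu)).
  rewrite {1}(divn_eq z (2 * nu)) addnC; elim: (_ %/ _) => [|b IH]; first by rewrite mul0n addn0.
  by rewrite (mulSnr b) addnA c_per.
have m0 : 0 < 2 * nu by lia.
move=> hx hy; rewrite (cmod x) (cmod y) => /c_inj.
rewrite !ltn_mod m0 => /(_ isT isT).
have := divn_eq x (2 * nu); have := divn_eq y (2 * nu).
have := ltn_pmod x m0; have := ltn_pmod y m0.
set A := x %/ _; set B := y %/ _; set C := x %% _; set D := y %% _.
clearbody A B C D => lD lC eY eX eCD; subst C.
have [AB|AB|AB] := ltngtP A B; last by rewrite eX AB -eY.
- have : A.+1 * (2 * nu) <= B * (2 * nu) by rewrite leq_mul2r AB orbT.
  rewrite mulSnr; lia.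
- have : B.+1 * (2 * nu) <= A * (2 * nu) by rewrite leq_mul2r AB orbT.
  rewrite mulSnr; lia.
Qed.

Lemma walk_path (w : nat -> nat) (a s : nat) :
    (forall i, i <= s -> a <= w i < a + 2 * nu) ->
    (forall i j, i < j <= s -> w i <> w j) ->
    (forall i, i < s -> E (c (w i)) (c (w i.+1))) ->
  let p := mkseq (fun i => c (w i.+1)) s in
  [/\ path E (c (w 0)) p, uniq (c (w 0) :: p), size p = s & last (c (w 0)) p = c (w s)].
Proof.
move=> w_win w_inj w_edge p.
have ep : c (w 0) :: p = mkseq (fun i => c (w i)) s.+1.
  by rewrite /p /mkseq /= -[1]addn0 iotaDl -map_comp.
split; last 2 first.
- by rewrite size_mkseq.
- by rewrite (last_nth (c (w 0))) ep size_mkseq nth_mkseq.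
- apply/(pathP (c (w 0))) => i; rewrite size_mkseq => i_s.
  by rewrite ep !nth_mkseq ?w_edge // ltnS ltnW.
- rewrite ep map_inj_in_uniq ?iota_uniq // => i j; rewrite !mem_iota !add0n !ltnS /= => is_ js e.
  have [ij|ij|//] := ltngtP i j.
  + by case: (w_inj i j) => //; [lia|]; apply: c_inj_window e; apply: w_win.
  + by case: (w_inj j i) => //; [lia|]; apply: c_inj_window (esym e); apply: w_win.
Qed.

Variables (P X : {set V}) (chi : V -> bool).
Hypothesis c_P : forall x, c (2 * x) \in P.
Hypothesis c_X : forall x, c x \in X.

(* A colouring of the even vertices that no path of length [2 * sigma] detects
   has period [2 * sigma] around the cycle; sending such paths through the chord
   adds two reflections whose composition is a translation by [2]. *)
Lemma theta_paths (sigma x0 : nat) :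
    0 < sigma < nu -> chi (c (2 * x0.+1)) != chi (c (2 * x0)) ->
  exists u p, [/\ path E u p, uniq (u :: p), {subset u :: p <= X},
    [/\ u \in P, last u p \in P & chi u != chi (last u p)] & size p = 2 * sigma].
Proof.
move=> /andP[s_gt0 s_lt] chi_x0; set s := 2 * sigma.
pose good u (p : s.-tuple V) :=
  [&& path E u p, uniq (u :: p), all (mem X) (u :: p), u \in P, last u p \in P
    & chi u != chi (last u p)].
have [/existsP[u /existsP[p /and5P[p1 p2 p3 p4 /andP[p5 p6]]]]|nogood] :=
    boolP [exists u, exists p : s.-tuple V, good u p].
  by exists u, p; split=> //; [apply/allP | rewrite size_tuple].
(* If no path of length [s] has ends of different colours, each injective index walk with even ends
   forces two colours to agree. *)
have undetected (w : nat -> nat) a : 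
    (forall i, i <= s -> a <= w i < a + 2 * nu) ->
    (forall i j, i < j <= s -> w i <> w j) ->
    (forall i, i < s -> E (c (w i)) (c (w i.+1))) ->
    forall y z, w 0 = 2 * y -> w s = 2 * z -> chi (c (2 * y)) = chi (c (2 * z)).
  move=> w1 w2 w3 y z ey ez; have [] := walk_path w1 w2 w3.
  set p := mkseq _ _ => p1 p2 p3 p4.
  apply/eqP; apply: contraNT nogood => chi_yz.
  apply/existsP; exists (c (w 0)); apply/existsP.
  have sp : size p == s by rewrite p3.
  exists (Tuple sp); rewrite /good /= p1 p4 ey ez !c_P chi_yz -ey.
  have -> /= : all (mem X) p by apply/allP => v /mapP[i _ ->]; exact: c_X.
  by move: p2; rewrite /= c_X => ->.
pose f x := chi (c (2 * x)).
have f_nu : periodic f nu by move=> x; rewrite /f mulnDr c_per.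
have f_sigma : periodic f sigma.
  move=> x; apply/esym; apply: (undetected (fun i => 2 * x + i) (2 * x)); try lia.
  by move=> i _; rewrite addnS c_edge.
have d_gt0 : 0 < gcdn sigma nu by rewrite gcdn_gt0 s_gt0.
have f_d := periodic_gcd s_gt0 f_sigma f_nu.
have d_s := dvdn_gcdl sigma nu; have d_n := dvdn_gcdr sigma nu.
(* Here [y] represents [- x] modulo [sigma]. *)
have solve x : exists2 y, y < sigma & exists v, x + y + v * sigma = sigma * x.+1.
  exists ((sigma * x.+1 - x) %% sigma); first by rewrite ltn_mod.
  exists ((sigma * x.+1 - x) %/ sigma).
  have := divn_eq (sigma * x.+1 - x) sigma.
  have := leq_pmull x.+1 s_gt0; lia.
(* Start from the gcd of [sigma] and [nu]. If it exceeds [rho] or is at least [nu - rho], walks that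
   keep their direction across the chord yield the further period [rho], respectively [rho + 1] and
   hence [nu - rho.+1]; the gcd with that period is small enough. *)
have [d [{}d_gt0 {}d_n {}d_s {}f_d [d_rho d_rho']]] :
    exists d, [/\ 0 < d, d %| nu, d %| sigma, periodic f d & d <= rho /\ d + rho < nu].
  set d := gcdn sigma nu in d_gt0 f_d d_s d_n.
  have d_le : d <= sigma by apply: dvdn_leq.
  have d_le' : sigma + d <= nu.
    have := dvdn_leq _ (dvdn_sub d_n d_s); rewrite subn_gt0 => /(_ s_lt); lia.
  clearbody d.
  have [d_rho|rho_d] := leqP d rho; last first.
    have f_rho : periodic f rho.
      have aux y : y < sigma -> f (nu - y) = f (rho + sigma - y).
        move=> y_s.
        pose w i := if i <= 2 * y then 2 * (nu - y) + i else 2 * rho + 1 + (i - 2 * y - 1).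
        apply: (undetected w (2 * rho + 1)).
        - by move=> i i_s; rewrite /w; case: ifP; lia.
        - by move=> i j ij; rewrite /w; case: ifP; case: ifP; lia.
        - move=> i i_s; rewrite /w.
          have [i1|i1|->] := ltngtP i (2 * y).
          + by rewrite addnS c_edge.
          + by have -> : i.+1 - 2 * y - 1 = (i - 2 * y - 1).+1; [lia | rewrite (addnS (2 * rho + 1)) c_edge].
          + rewrite subSnn addn0.
            have -> : 2 * (nu - y) + 2 * y = 0 + 2 * nu by lia.
            by rewrite c_per.
        - by rewrite /w /=; lia.
        - by rewrite /w; case: ifP; lia.
      move=> x; have [y y_s [v ey]] := solve x.
      have -> : f x = f (nu - y).
        by rewrite -f_nu; apply: (@periodic_eq f sigma v x.+1) => //; lia.
      rewrite aux //; apply: (@periodic_eq f sigma v.+1 x.+1) => //; lia.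
    exists (gcdn d rho); split.
    - by rewrite gcdn_gt0 d_gt0.
    - exact: dvdn_trans (dvdn_gcdl _ _) d_n.
    - exact: dvdn_trans (dvdn_gcdl _ _) d_s.
    - exact: periodic_gcd.
    - have := dvdn_leq rho_gt0 (dvdn_gcdr d rho); lia.
  have [d_rho'|rho_d'] := leqP nu (d + rho); last by exists d.
  have f_rho : periodic f (rho + 1).
    have aux y : y < sigma -> f y = f (rho + 1 - sigma + y).
      move=> y_s.
      pose w i := if i <= 2 * y then 2 * y - i else 2 * rho + 1 - (i - 2 * y - 1).
      apply: (undetected w 0).
      - by move=> i i_s; rewrite /w; case: ifP; lia.
      - by move=> i j ij; rewrite /w; case: ifP; case: ifP; lia.
      - move=> i i_s; rewrite /w.
        have [i1|i1|->] := ltngtP i (2 * y).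
        + by rewrite Esym; have -> : 2 * y - i = (2 * y - i.+1).+1; [lia|].
        + rewrite Esym.
          by have -> : 2 * rho + 1 - (i - 2 * y - 1) = (2 * rho + 1 - (i.+1 - 2 * y - 1)).+1; [lia|].
        + by rewrite subnn subSnn subn0.
      - by rewrite /w /=; lia.
      - by rewrite /w; case: ifP; lia.
    move=> x; have sx := leq_pmull x s_gt0.
    have -> : f x = f (x %% sigma).
      by apply: (@periodic_eq f sigma 0 (x %/ sigma)) => //; have := divn_eq x sigma; lia.
    rewrite [RHS]aux ?ltn_mod //.
    by apply: (@periodic_eq f sigma 0 (x %/ sigma).+1) => //; have := divn_eq x sigma; lia.
  have f_rho' : periodic f (nu - rho.+1).
    move=> x; rewrite -f_rho -[in RHS]f_nu; congr f; lia.
  have gap_gt0 : 0 < nu - rho.+1 by rewrite subn_gt0.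
  have d_gcd := dvdn_leq gap_gt0 (dvdn_gcdr d (nu - rho.+1)).
  exists (gcdn d (nu - rho.+1)); split.
  - by rewrite gcdn_gt0 d_gt0.
  - exact: dvdn_trans (dvdn_gcdl _ _) d_n.
  - exact: dvdn_trans (dvdn_gcdl _ _) d_s.
  - exact: periodic_gcd.
  - have := dvdn_leq d_gt0 (dvdn_gcdl d (nu - rho.+1)).
    move: d_gcd; move: (gcdn _ _) => g; lia.
case/negP: chi_x0; apply/eqP; rewrite -/(f x0) -/(f x0.+1).
(* Both walks now turn round at the chord: one climbs to [2 * nu] and descends from [2 * rho + 1],
   the other descends to 0 and climbs from [2 * rho + 1]. *)
apply: (@reflections_constant f nu rho sigma d) => //.
- by rewrite s_gt0.
- move=> y y1 y2 y3.
  pose w i := if i <= 2 * y then 2 * (nu - y) + i else 2 * rho + 1 - (i - 2 * y - 1).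
  apply: (undetected w 1).
  + by move=> i i_s; rewrite /w; case: ifP; lia.
  + by move=> i j ij; rewrite /w; case: ifP; case: ifP; lia.
  + move=> i i_s; rewrite /w.
    have [i1|i1|->] := ltngtP i (2 * y).
    * by rewrite addnS c_edge.
    * rewrite Esym.
      by have -> : 2 * rho + 1 - (i - 2 * y - 1) = (2 * rho + 1 - (i.+1 - 2 * y - 1)).+1; [lia|].
    * rewrite subSnn subn0.
      have -> : 2 * (nu - y) + 2 * y = 0 + 2 * nu by lia.
      by rewrite c_per.
  + by rewrite /w /=; lia.
  + by rewrite /w; case: ifP; lia.
- move=> y y1 y2 y3.
  pose w i := if i <= 2 * y then 2 * y - i else 2 * rho + 1 + (i - 2 * y - 1).
  apply: (undetected w 0).
  + by move=> i i_s; rewrite /w; case: ifP; lia.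
  + by move=> i j ij; rewrite /w; case: ifP; case: ifP; lia.
  + move=> i i_s; rewrite /w.
    have [i1|i1|->] := ltngtP i (2 * y).
    * by rewrite Esym; have -> : 2 * y - i = (2 * y - i.+1).+1; [lia|].
    * by have -> : i.+1 - 2 * y - 1 = (i - 2 * y - 1).+1; [lia | rewrite (addnS (2 * rho + 1)) c_edge].
    * by rewrite subnn subSnn addn0.
  + by rewrite /w /=; lia.
  + by rewrite /w; case: ifP; lia.
Qed.

End ThetaPaths.

(** * Edge counts, dense subgraphs, and a long cycle with a chord *)

Section Counting.
Variables (V : finType) (E : rel V).
Implicit Types (A B C P Q X Y : {set V}).

Definition deg_in (x : V) (A : {set V}) : nat := \sum_(y in A) E x y.

(** Ordered pairs are counted: an edge inside [X] contributes 2 to [adjacent_pairs E X X], an edge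
    between disjoint sets only 1. This explains the factors 2 and 4 below. *)
Definition adjacent_pairs (A B : {set V}) : nat := \sum_(x in A) deg_in x B.

Definition bipartite_rel (P Q : {set V}) : rel V :=
  [rel x y | E x y && ((x \in P) && (y \in Q) || (x \in Q) && (y \in P))].

Lemma deg_inE x A : deg_in x A = #|[set y in A | E x y]|.
Proof.
rewrite -sum1_card /deg_in big_mkcond [RHS]big_mkcond.
by apply: eq_bigr => y _; rewrite inE; case: (y \in A) (E x y) => [] [].
Qed.

Lemma deg_in_gt0 x A : 0 < deg_in x A -> exists2 y, y \in A & E x y.
Proof. by rewrite deg_inE => /card_gt0P[y]; rewrite inE => /andP[]; exists y. Qed.

Lemma deg_inID x A B : deg_in x A = deg_in x (A :&: B) + deg_in x (A :\: B).
Proof. exact: big_setID. Qed.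

Lemma deg_in_subset x A B : A \subset B -> deg_in x A <= deg_in x B.
Proof. by move=> sAB; rewrite (deg_inID x B A) (setIidPr sAB) leq_addr. Qed.

Lemma deg_in_le_card x A : deg_in x A <= #|A|.
Proof. by rewrite deg_inE subset_leq_card //; apply/subsetP => y; rewrite inE => /andP[]. Qed.

Lemma pairsIDl A B C :
  adjacent_pairs A B = adjacent_pairs (A :&: C) B + adjacent_pairs (A :\: C) B.
Proof. exact: big_setID. Qed.

Lemma pairsIDr A B C :
  adjacent_pairs A B = adjacent_pairs A (B :&: C) + adjacent_pairs A (B :\: C).
Proof. by rewrite -big_split; apply: eq_bigr => x _; apply: deg_inID. Qed.

Lemma pairs_subset A B A' B' :
  A \subset A' -> B \subset B' -> adjacent_pairs A B <= adjacent_pairs A' B'.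
Proof.
move=> sA sB; rewrite (pairsIDl A' B' A) (setIidPr sA) (pairsIDr A B' B) (setIidPr sB).
by rewrite -addnA leq_addr.
Qed.

Lemma pairs_le A B d :
  (forall x, x \in A -> deg_in x B <= d) -> adjacent_pairs A B <= #|A| * d.
Proof. by move=> h; rewrite -sum_nat_const; apply: leq_sum. Qed.

Lemma pairs_ge A B d :
  (forall x, x \in A -> d <= deg_in x B) -> #|A| * d <= adjacent_pairs A B.
Proof. by move=> h; rewrite -sum_nat_const; apply: leq_sum. Qed.

Hypothesis Esym : symmetric E.

Lemma pairsC A B : adjacent_pairs A B = adjacent_pairs B A.
Proof.
rewrite /adjacent_pairs exchange_big /=.
by apply: eq_bigr => x _; rewrite /deg_in; apply: eq_bigr => y _; rewrite Esym.
Qed.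

Lemma bipartite_relC P Q : symmetric (bipartite_rel P Q).
Proof. by move=> x y; rewrite /bipartite_rel /= Esym; do 4!case: (_ \in _). Qed.

Lemma pairs_self X A : A \subset X ->
  adjacent_pairs X X =
  adjacent_pairs A A + 2 * adjacent_pairs A (X :\: A) + adjacent_pairs (X :\: A) (X :\: A).
Proof.
move=> sAX; rewrite (pairsIDl X X A) !(pairsIDr _ X A) (setIidPr sAX).
rewrite (pairsC (X :\: A) A); lia.
Qed.

End Counting.

(** * Subgraphs of large minimum degree *)

Section Peeling.
Variables (V : finType) (E : rel V) (Esym : symmetric E) (Eirr : irreflexive E).
Implicit Types X Y : {set V}.

Lemma pairs_remove X x : x \in X ->
  adjacent_pairs E X X = 2 * deg_in E x X + adjacent_pairs E (X :\ x) (X :\ x).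
Proof.
move=> xX; rewrite (@pairs_self _ E Esym X [set x]) ?sub1set //.
have one A : adjacent_pairs E [set x] A = deg_in E x A by rewrite /adjacent_pairs big_set1.
rewrite !one (deg_inID E x X [set x]) (setIidPr _) ?sub1set //.
by rewrite {1 3}/deg_in big_set1 Eirr.
Qed.

(** Deleting a vertex [x] of degree at most [w x] removes at most [2 * w x] ordered pairs, so the
    strict inequality survives and deletion stops before the empty set. *)
Lemma peel (X : {set V}) (w : V -> nat) :
    2 * \sum_(x in X) w x < adjacent_pairs E X X ->
  exists2 Y : {set V}, Y \subset X & Y != set0 /\ forall y, y \in Y -> w y < deg_in E y Y.
Proof.
have [m] := ubnP #|X|; elim: m X => // m IHm X; rewrite ltnS => Xm wX.
have [/forall_inP all_big|] := boolP [forall x in X, w x < deg_in E x X].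
  exists X => //; split => //; apply: contraTneq wX => ->.
  by rewrite /adjacent_pairs !big_set0 muln0.
rewrite negb_forall_in => /exists_inP[x xX]; rewrite -leqNgt => small.
have [||Y sYX HY] := IHm (X :\ x).
- by rewrite (cardsD1 x X) xX in Xm.
- by move: wX; rewrite (big_setD1 x) //= (pairs_remove xX); lia.
- by exists Y => //; apply: subset_trans sYX (subsetDl _ _).
Qed.

End Peeling.

Section UnextendablePath.
Variables (V : finType) (E : rel V) (Esym : symmetric E).

(** Vertices are prepended until the first vertex has no neighbour in [X] off the path. *)
Lemma unextendable_path (X : {set V}) : X != set0 ->
  exists x p, [/\ path E x p, uniq (x :: p), {subset x :: p <= X} &
    forall y, y \in X -> E x y -> y \in x :: p].
Proof.
case/set0Pn=> x0 x0X.
have [N size_le] : exists N, forall p : seq V, uniq p -> size p <= N.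
  by exists #|V| => p up; rewrite -(card_uniqP up) max_card.
suff H m x p : N - size p < m -> path E x p -> uniq (x :: p) -> {subset x :: p <= X} ->
  exists x p, [/\ path E x p, uniq (x :: p), {subset x :: p <= X} &
    forall y, y \in X -> E x y -> y \in x :: p].
  by apply: (H N.+1 x0 [::]) => // [|y]; rewrite ?subn0 // inE => /eqP ->.
elim: m x p => // m IHm x p lt_m px ux sx.
have [/forallP h|] := boolP [forall y, (y \in X) && E x y ==> (y \in x :: p)].
  by exists x, p; split=> // y yX xy; have := h y; rewrite yX xy.
rewrite negb_forall => /existsP[y]; rewrite negb_imply => /andP[/andP[yX xy] yp].
apply: (IHm y (x :: p)).
- have uy : uniq (y :: x :: p) by rewrite cons_uniq yp.
  by have := size_le _ uy; rewrite /=; lia.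
- by rewrite /= Esym xy.
- by rewrite cons_uniq yp.
- by move=> z; rewrite inE => /predU1P[->|/sx].
Qed.

End UnextendablePath.

Lemma odd_halfE n : odd n -> n = 2 * n./2 + 1.
Proof. by move=> n_odd; rewrite -[LHS]odd_double_half n_odd -muln2 mulnC addnC. Qed.

(** * Even paths with ends of different colours *)

Section BichromaticPaths.
Variables (V : finType) (E : rel V) (Esym : symmetric E).
Variables (P Q X : {set V}) (k : nat).
Hypotheses (disjPQ : [disjoint P & Q]) (k_gt1 : 1 < k) (X_neq0 : X != set0).
Local Notation e := (bipartite_rel E P Q).
Hypothesis deg_gt : forall x, x \in X -> k < deg_in e x X.

Lemma bipartite_path_parity x p i : path e x p -> i <= size p ->
    x \in P :|: Q ->
  nth x (x :: p) i \in P :|: Q /\ (nth x (x :: p) i \in P) = (x \in P) (+) odd i.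
Proof.
move=> px; elim: i => [|i IHi] i_p xPQ; first by rewrite addbF.
have [yPQ eqP] := IHi (ltnW i_p) xPQ.
have /(pathP x)/(_ i i_p) := px; rewrite /= => edge.
have nP z : z \in Q -> z \in P = false by move=> zQ; rewrite (disjointFl disjPQ zQ).
move: eqP edge; rewrite /bipartite_rel /=; set y := nth x (x :: p) i; set z := nth x p i.
move=> eqP /andP[_ /orP[] /andP[h1 h2]]; rewrite !inE h2 ?orbT; split=> //.
- by rewrite nP // addbN -eqP h1.
- by rewrite addbN -eqP nP.
Qed.

(** All neighbours of the first vertex of an unextendable path lie on it, at odd indices by
    bipartiteness. The farthest one closes the cycle; one strictly between index 1 and the farthest
    gives the chord. *)
Lemma chorded_path : exists x p nu rho,
  [/\ path e x p, uniq (x :: p) /\ x \in P :|: Q, {subset x :: p <= X} /\ 2 * nu <= (size p).+1,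
      e x (nth x (x :: p) (2 * nu).-1) /\ e x (nth x (x :: p) (2 * rho + 1))
    & [/\ 0 < rho, rho.+1 < nu & k < nu]].
Proof.
have [x [p [px ux sx maxp]]] := unextendable_path (bipartite_relC Esym P Q) X_neq0.
have xX : x \in X by apply: sx; rewrite mem_head.
have xPQ : x \in P :|: Q.
  have /deg_in_gt0[y _] : 0 < deg_in e x X by apply: leq_ltn_trans (deg_gt xX).
  by rewrite inE => /andP[_ /orP[] /andP[->]]; rewrite ?orbT.
pose D := [set y in X | e x y].
have D_k : k < #|D| by rewrite -deg_inE deg_gt.
pose v i := nth x (x :: p) i; pose ix y := index y (x :: p).
have v_inj i j : i <= size p -> j <= size p -> v i = v j -> i = j.
  by move=> hi hj /eqP; rewrite nth_uniq // => /eqP.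
have ixP y : y \in D -> [/\ v (ix y) = y, ix y <= size p & odd (ix y)].
  rewrite inE => /andP[yX xy]; have yp := maxp y yX xy.
  have ix_le : ix y <= size p by have : ix y < size (x :: p) by rewrite index_mem.
  have vy : v (ix y) = y by apply: nth_index.
  split=> //; have [yPQ] := bipartite_path_parity px ix_le xPQ.
  rewrite -/(v (ix y)) vy; move: xy; rewrite /bipartite_rel /=.
  have nP z : z \in Q -> z \in P = false by move=> zQ; rewrite (disjointFl disjPQ zQ).
  move=> /andP[_ /orP[] /andP[h1 h2]].
  + by rewrite h1 (nP y) //=; case: (odd _).
  + by rewrite h2 (nP x) //=; case: (odd _).
have [y0 y0D] : exists y, y \in D by apply/card_gt0P; lia.
case: (arg_maxnP ix y0D) => ya /= yaD0 ya_max0.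
have yaD : ya \in D by exact: yaD0.
have ya_max y : y \in D -> ix y <= ix ya by exact: ya_max0.
clear yaD0 ya_max0.
set a := ix ya in ya_max.
have [v_a a_p a_odd] : [/\ v a = ya, a <= size p & odd a] := ixP ya yaD.
clearbody a.
pose nu := a.+1./2.
have a_nu : a.+1 = 2 * nu by rewrite /nu -[LHS]odd_double_half /= a_odd -muln2 mulnC.
clearbody nu.
(* Halving the odd indices maps more than [k] neighbours injectively into [nu] values; the reduction
   modulo [nu] only serves the type. *)
have k_nu : k < nu.
  apply: leq_trans D_k _; rewrite -[nu]card_ord.
  have nu_gt0 : 0 < nu by lia.
  pose g y := Ordinal (ltn_pmod (ix y)./2 nu_gt0).
  rewrite -(@card_in_imset _ _ g D) ?max_card // => y z yD zD [].
  have [vy y_p y_odd] := ixP y yD; have [vz z_p z_odd] := ixP z zD.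
  have := ya_max y yD; have := ya_max z zD => hz hy.
  have := odd_halfE z_odd; have := odd_halfE y_odd.
  move: (ix z)./2 (ix y)./2 => mz my ey ez.
  have my_lt : my < nu by move: hy; rewrite ey; clear -a_nu; lia.
  have mz_lt : mz < nu by move: hz; rewrite ez; clear -a_nu; lia.
  rewrite !modn_small //.
  by move=> eyz; rewrite -vy -vz ey ez eyz.
(* Since [k > 1] there are at least three neighbours, and only the indices 1 and [a] are
   discarded. *)
have [yr yrD] : exists2 y, y \in D & 1 < ix y < a.
  have : 0 < #|(D :\ ya) :\ v 1|.
    have := cardsD1 ya D; have := cardsD1 (v 1) (D :\ ya).
    move: D_k; clear -k_gt1; by do 2!case: (_ \in _); lia.
  case/card_gt0P=> y; rewrite !in_setD1 => /and3P[y1 ya' yD]; exists y => //.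
  have [vy y_p y_odd] := ixP y yD.
  rewrite [_ < a]ltn_neqAle ya_max // andbT.
  apply/andP; split.
    by case: (ix y) y_odd vy => [|[|i]] //= _ /eqP; rewrite eq_sym (negPf y1).
  apply: contraNneq ya' => e_ix; by rewrite -vy e_ix v_a.
set r := ix yr => /andP[r_gt1 r_a].
have [v_r r_p r_odd] : [/\ v r = yr, r <= size p & odd r] := ixP yr yrD.
clearbody r.
have [rho r_rho] : exists rho, r = 2 * rho + 1 by exists r./2; apply: odd_halfE.
exists x, p, nu, rho; rewrite -r_rho -/(v r) v_r.
have -> : (2 * nu).-1 = a by rewrite -a_nu.
have [xya xyr] : e x ya /\ e x yr.
  by move: yaD yrD; rewrite !inE => /andP[_ ->] /andP[_ ->].
rewrite -/(v a) v_a.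
split=> //; first by split=> //; rewrite -a_nu.
clear -r_gt1 r_a r_rho a_nu k_nu; split; lia.
Qed.

Lemma cycle_with_chord : exists c nu rho,
  [/\ [/\ forall x, c (x + 2 * nu) = c x,
        forall x y, x < 2 * nu -> y < 2 * nu -> c x = c y -> x = y,
        forall x, e (c x) (c x.+1) & e (c 0) (c (2 * rho + 1))],
      [/\ 0 < rho, rho.+1 < nu & k < nu],
      forall x, c (2 * x) \in P & forall x, c x \in X].
Proof.
have [x [p [nu [rho [px [ux xPQ] [sx nu_p] [x_last x_chord] [rho_gt0 rho_nu k_nu]]]]]] :=
  chorded_path.
have nP z : z \in Q -> z \in P = false by move=> zQ; rewrite (disjointFl disjPQ zQ).
have nu_gt0 : 0 < 2 * nu by lia.
have rho_lt : 2 * rho + 1 < 2 * nu by lia.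
have parity i : i <= size p -> (nth x (x :: p) i \in P) = (x \in P) (+) odd i.
  by move=> i_p; have [] := bipartite_path_parity px i_p xPQ.
have nth_lt i : i %% (2 * nu) <= size p.
  by rewrite -ltnS; apply: leq_trans nu_p; rewrite ltn_mod.
have next_mod i : i.+1 %% (2 * nu) = (i %% (2 * nu)).+1 \/
    i.+1 %% (2 * nu) = 0 /\ i %% (2 * nu) = (2 * nu).-1.
  have := ltn_pmod i nu_gt0; rewrite -[i.+1]addn1 -modnDml.
  move: (i %% _) => j; rewrite leq_eqVlt => /orP[/eqP ej|j_lt].
    by right; rewrite addn1 ej modnn -ej.
  by left; rewrite addn1 modn_small.
have opposite : 2 * (nu - rho.+1) + 1 + (2 * rho + 1) = 0 + 2 * nu by lia.
pose v i := nth x (x :: p) i; pose c0 i := v (i %% (2 * nu)).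
have v_inj i j : i <= size p -> j <= size p -> v i = v j -> i = j.
  by move=> hi hj /eqP; rewrite nth_uniq // => /eqP.
have c0_per i : c0 (i + 2 * nu) = c0 i by rewrite /c0 modnDr.
have c0_small i : i < 2 * nu -> c0 i = v i by move=> h; rewrite /c0 modn_small.
have c0_edge i : e (c0 i) (c0 i.+1).
  rewrite /c0; have := nth_lt i.+1; have [->|[-> ->]] := next_mod i.
    by move=> i_p; have /(pathP x) := px; apply.
  by move=> _; rewrite (bipartite_relC Esym).
have c0_X i : c0 i \in X by apply: sx; rewrite mem_nth //= ltnS.
have c0_P i : (c0 i \in P) = (x \in P) (+) odd i.
  rewrite parity //; congr (_ (+) _).
  by rewrite [in RHS](divn_eq i (2 * nu)) oddD !oddM /= andbF.
have shift_inj d i j : i < 2 * nu -> j < 2 * nu -> c0 (i + d) = c0 (j + d) -> i = j.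
  move=> hi hj /v_inj; rewrite !nth_lt => /(_ isT isT) /eqP.
  by rewrite eqn_modDr !modn_small // => /eqP.
have [xP|xP] := boolP (x \in P).
  exists c0, nu, rho; split=> [||i|//]; last by rewrite c0_P xP oddM.
  + split=> // [i j hi hj|].
      by have := shift_inj 0 i j hi hj; rewrite !addn0.
    by rewrite /c0 !modn_small.
  + by [].
(* If the path starts in [Q], rotation by the odd amount [2 * rho + 1] brings [P] to the even
   indices, and the chord is read from its other end. *)
exists (fun i => c0 (i + (2 * rho + 1))), nu, (nu - rho.+1); split=> [||i|i].
+ split=> [i|i j|i|].
  * by rewrite addnAC c0_per.
  * exact: shift_inj.
  * by rewrite addSn.
  * by rewrite opposite c0_per add0n (bipartite_relC Esym) /c0 !modn_small.
+ by clear -rho_gt0 rho_nu k_nu; split; lia.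
+ by rewrite c0_P (negPf xP) oddD (oddD (2 * rho)) !oddM.
+ by [].
Qed.

(** [C] consists of the vertices at even indices of the cycle. It is fixed before the colouring and
    the length, so a single colouring can serve all [k] lengths. *)
Lemma bichromatic_paths : exists2 C : {set V}, C \subset P &
  1 < #|C| /\ forall (chi : V -> bool) s, 0 < s <= k ->
    (exists u v, [/\ u \in C, v \in C & chi u != chi v]) ->
  exists u p, [/\ path e u p, uniq (u :: p), {subset u :: p <= X},
    [/\ u \in C, last u p \in C & chi u != chi (last u p)] & size p = 2 * s].
Proof.
have [c [nu [rho [[c1 c2 c3 c4] [r1 r2 r3] cP cX]]]] := cycle_with_chord.
pose C := [set c (2 * i) | i : 'I_nu].
exists C; first by apply/subsetP => _ /imsetP[i _ ->].
split.
  rewrite card_imset ?card_ord; first by lia.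
  by move=> i j /c2 eij; apply: val_inj; have := eij; case: i j {eij} => i hi [j hj] /=; lia.
move=> chi s /andP[s0 sk] [u [v [/imsetP[i _ ->] /imsetP[j _ ->] chi_ij]]].
have [x0 hx0] : exists x0 : 'I_nu, chi (c (2 * x0.+1)) != chi (c (2 * x0)).
  apply/existsP; apply: contraNT chi_ij; rewrite negb_exists => /forallP h.
  have h0 x : chi (c (2 * x)) = chi (c 0).
    elim: x => // x <-; have nu_gt0 : 0 < nu by lia.
    have /negPn/eqP := h (Ordinal (ltn_pmod x nu_gt0)); rewrite /=.
    have eC z : c (2 * (z + x %/ nu * nu)) = c (2 * z).
      elim: (_ %/ _) => [|b IH]; first by rewrite mul0n addn0.
      by rewrite (mulSnr b) addnA mulnDr c1.
    rewrite -(eC (x %% nu)) -(eC (x %% nu).+1) addSn.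
    by rewrite [_ %% _ + _]addnC -divn_eq => ->.
  by rewrite !h0.
have cC x : c (2 * x) \in C.
  have nu_gt0 : 0 < nu by lia.
  have eC z : c (2 * (z + x %/ nu * nu)) = c (2 * z).
    elim: (_ %/ _) => [|b IH]; first by rewrite mul0n addn0.
    by rewrite (mulSnr b) addnA mulnDr c1.
  rewrite {1}(divn_eq x nu) addnC eC.
  by apply/imsetP; exists (Ordinal (ltn_pmod x nu_gt0)).
by apply: (@theta_paths V e _ c nu rho) (hx0) => //; [apply: bipartite_relC | lia].
Qed.

End BichromaticPaths.

(** * Breadth-first layers *)

Section DenseSubgraphs.
Variables (V : finType) (E : rel V) (Esym : symmetric E) (Eirr : irreflexive E).
Implicit Types (A B H L P Q U X Y : {set V}).

(** Vertices are added one at a time to the side that holds fewer of their neighbours, which cuts at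
    least half of the edges. *)
Lemma max_cut L : exists2 P : {set V}, P \subset L &
  adjacent_pairs E L L <= 4 * adjacent_pairs E P (L :\: P).
Proof.
have [m] := ubnP #|L|; elim: m L => // m IHm L; rewrite ltnS => Lm.
have [->|/set0Pn[x xL]] := eqVneq L set0.
  by exists set0; rewrite ?sub0set // /adjacent_pairs !big_set0.
have [|P sPL cutP] := IHm (L :\ x); first by rewrite (cardsD1 x L) xL in Lm.
have xP : x \notin P by apply: contraTN xL => /(subsetP sPL); rewrite !inE eqxx.
have sPL' : P \subset L by apply: subset_trans sPL (subsetDl _ _).
have degL : deg_in E x L = deg_in E x P + deg_in E x ((L :\ x) :\: P).
  rewrite (deg_inID E x L P) (setIidPr sPL'); congr (_ + _).
  rewrite (deg_inID E x (L :\: P) [set x]) (_ : _ :&: [set x] = [set x]) //; last first.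
    by apply/setIidPr; rewrite sub1set inE xP.
  rewrite {1}/deg_in big_set1 Eirr add0n; congr deg_in.
  by apply/setP => z; rewrite !inE andbCA.
have one A : adjacent_pairs E [set x] A = deg_in E x A by rewrite /adjacent_pairs big_set1.
rewrite (pairs_remove Esym Eirr xL).
have [more_P|less_P] := leqP (deg_in E x ((L :\ x) :\: P)) (deg_in E x P).
  exists P => //.
  rewrite (pairsIDr E P _ [set x]) (_ : _ :&: [set x] = [set x]); last first.
    by apply/setIidPr; rewrite sub1set inE xP.
  rewrite (pairsC Esym P [set x]) one.
  have -> : (L :\: P) :\ x = (L :\ x) :\: P by apply/setP => z; rewrite !inE andbCA.
  lia.
exists (x |: P); first by rewrite subUset sub1set xL.
rewrite (pairsIDl E (x |: P) _ [set x]) (_ : _ :&: [set x] = [set x]); last first.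
  by apply/setIidPr; rewrite sub1set !inE eqxx.
have -> : (x |: P) :\ x = P by rewrite setU1K.
have -> : L :\: (x |: P) = (L :\ x) :\: P.
  by apply/setP => z; rewrite !inE negb_or -andbA andbCA.
rewrite one; lia.
Qed.

(** Deleting a set [U] that costs at most [d * #|U|] pairs preserves the density hypothesis; the
    core is reached when no such [U] is left. *)
Lemma dense_core X d : d * #|X| < adjacent_pairs E X X ->
  exists2 H : {set V}, H \subset X & H != set0 /\ forall U, U \subset H -> U != set0 ->
    adjacent_pairs E (H :\: U) (H :\: U) + d * #|U| < adjacent_pairs E H H.
Proof.
have [m] := ubnP #|X|; elim: m X => // m IHm X; rewrite ltnS => Xm dX.
have [/forallP h|] := boolP [forall U : {set V}, (U \subset X) && (U != set0) ==>
    (adjacent_pairs E (X :\: U) (X :\: U) + d * #|U| < adjacent_pairs E X X)].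
  exists X => //; split=> [|U sU U0]; last by have := h U; rewrite sU U0.
  by apply: contraTneq dX => ->; rewrite /adjacent_pairs big_set0.
rewrite negb_forall => /existsP[U]; rewrite negb_imply -leqNgt => /andP[/andP[sU U0] dU].
have cX : #|X| = #|U| + #|X :\: U| by rewrite -(cardsID U X) (setIidPr sU).
have U_gt0 : 0 < #|U| by rewrite card_gt0.
have [||H sH hH] := IHm (X :\: U); first by lia.
  by have := dU; have := dX; rewrite cX mulnDr; lia.
by exists H => //; apply: subset_trans sH (subsetDl _ _).
Qed.

Lemma bipartite_core P Q k : [disjoint P & Q] ->
    k * (#|P| + #|Q|) < adjacent_pairs E P Q ->
  exists2 Y : {set V}, Y \subset P :|: Q & Y != set0 /\
    forall y, y \in Y -> k < deg_in (bipartite_rel E P Q) y Y.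
Proof.
move=> dPQ dense; have e_irr : irreflexive (bipartite_rel E P Q).
  by move=> x; rewrite /bipartite_rel /= Eirr.
have e_sym := bipartite_relC Esym P Q.
apply: (@peel _ (bipartite_rel E P Q) e_sym e_irr (P :|: Q) (fun=> k)).
have dPQ' : P :&: Q = set0 by apply/setP => x; rewrite !inE; apply/andP => -[/(disjointFr dPQ) ->].
rewrite sum_nat_const cardsU dPQ' cards0 subn0.
rewrite (@pairs_self _ _ e_sym (P :|: Q) P) ?subsetUl //.
have -> : (P :|: Q) :\: P = Q.
  apply/setP => x; rewrite !inE; case xP: (x \in P) => //=.
  by rewrite (disjointFr dPQ xP).
have -> : adjacent_pairs (bipartite_rel E P Q) P Q = adjacent_pairs E P Q.
  apply: eq_bigr => x xP; apply: eq_bigr => y yQ.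
  by rewrite /bipartite_rel /= xP yQ /= andbT.
rewrite [_ * k]mulnC; lia.
Qed.

Section Layers.
Variables (H : {set V}) (root : V).
Hypothesis rootH : root \in H.

Fixpoint ball i : {set V} :=
  if i is j.+1 then ball j :|: [set v in H | 0 < deg_in E v (ball j)] else [set root].

Definition layer i : {set V} := if i is j.+1 then ball j.+1 :\: ball j else ball 0.

Lemma ball_subset i : ball i \subset H.
Proof.
elim: i => [|i IHi] /=; first by rewrite sub1set.
by rewrite subUset IHi; apply/subsetP => v; rewrite inE => /andP[].
Qed.

Lemma ball_mono i j : i <= j -> ball i \subset ball j.
Proof.
move=> /subnK <-; elim: (j - i) => //= d IHd.
exact: subset_trans IHd (subsetUl _ _).
Qed.

Lemma layer_ball i : layer i \subset ball i.
Proof. by case: i => //= i; apply: subsetDl. Qed.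

Lemma layer_inj v i j : v \in layer i -> v \in layer j -> i = j.
Proof.
have aux a b : a < b -> v \in layer a -> v \in layer b -> False.
  case: b => // b ab /(subsetP (layer_ball a)) /(subsetP (ball_mono (ab : a <= b))) vb.
  by rewrite /layer inE vb.
by have [ij|ij|//] := ltngtP i j => hi hj; [case: (aux i j)|case: (aux j i)].
Qed.

Lemma layer_parent v i : v \in layer i.+1 -> exists2 u, u \in layer i & E v u.
Proof.
rewrite /layer -/layer inE /= => /andP[v_old]; rewrite inE (negPf v_old) /= inE.
case/andP=> vH /deg_in_gt0[u u_i vu]; exists u => //.
case: i v_old u_i => //= i; rewrite !inE => /norP[v1 v2] u_i; rewrite u_i andbT.
apply: contra v2 => ui; rewrite vH deg_inE; apply/card_gt0P; exists u.
by rewrite inE ui.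
Qed.

Lemma ball_edges i j u v : u \in ball i -> v \in H -> E u v -> i < j -> v \in ball j.
Proof.
move=> ui vH uv ij; apply: (subsetP (ball_mono ij)) => /=.
rewrite !inE vH deg_inE; apply/orP; right; apply/card_gt0P; exists u.
by rewrite inE ui Esym.
Qed.

Lemma pairs_no_edge A B : (forall u v, u \in A -> v \in B -> E u v = false) ->
  adjacent_pairs E A B = 0.
Proof.
move=> h; rewrite /adjacent_pairs big1 // => u uA; rewrite /deg_in big1 // => v vB.
by rewrite h.
Qed.

Lemma pairs_ball_layer i :
  adjacent_pairs E (ball i) (layer i.+1) = adjacent_pairs E (layer i) (layer i.+1).
Proof.
rewrite (pairsIDl E (ball i) _ (layer i)) (setIidPr (layer_ball i)).
rewrite [X in _ + X]pairs_no_edge ?addn0 // => u v.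
case: i => [|i]; first by rewrite /= setDv inE.
rewrite inE => /andP[u1 u2]; rewrite inE => /andP[v1 v2].
have ui : u \in ball i by apply: contraNT u1 => u1; rewrite inE u1.
apply/negbTE; apply: contra v1 => uv.
by apply: ball_edges ui _ uv _ => //; apply: (subsetP (ball_subset i.+2)).
Qed.

Lemma card_ballS i : #|ball i.+1| = #|ball i| + #|layer i.+1|.
Proof. by rewrite -(cardsID (ball i) (ball i.+1)) (setIidPr (ball_mono _)). Qed.

Lemma pairs_ballS i : adjacent_pairs E (ball i.+1) (ball i.+1) =
  adjacent_pairs E (ball i) (ball i) + 2 * adjacent_pairs E (layer i) (layer i.+1)
  + adjacent_pairs E (layer i.+1) (layer i.+1).
Proof.
by rewrite (@pairs_self _ _ Esym _ (ball i)) ?ball_mono // -pairs_ball_layer.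
Qed.

(** Otherwise the balls would grow by a factor above 9/8 at each of [D] steps and outgrow [H]. *)
Lemma slow_growth D : 8 ^ D * #|H| < 9 ^ D ->
  exists2 i, i < D & 8 * #|ball i.+1| <= 9 * #|ball i|.
Proof.
move=> hD; have [/existsP[i hi]|] := boolP [exists i : 'I_D, 8 * #|ball i.+1| <= 9 * #|ball i|].
  by exists i.
rewrite negb_exists => /forallP fast.
have grow i : i <= D -> 9 ^ i <= 8 ^ i * #|ball i|.
  elim: i => [|i IHi] iD; first by rewrite cards1.
  have := fast (Ordinal iD); rewrite -ltnNge /= => /ltnW lt_i.
  have := IHi (ltnW iD) => h.
  rewrite !expnSr -mulnA; apply: leq_trans (leq_mul h (leqnn 9)) _.
  by rewrite -mulnA leq_mul2l [_ * 9]mulnC lt_i orbT.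
have := grow D (leqnn D); have := subset_leq_card (ball_subset D).
move=> h1 h2; have := leq_mul (leqnn (8 ^ D)) h1; lia.
Qed.

(** If all these layers and consecutive pairs were sparse, a ball would have at most [8 * k] pairs
    per vertex. At a step of slow growth this is at most [9 * k] per vertex of the smaller ball,
    against the core property for that ball. *)
Lemma dense_layer k D : 8 ^ D * #|H| < 9 ^ D ->
    (forall U, U \subset H -> U != set0 ->
      adjacent_pairs E (H :\: U) (H :\: U) + 9 * k * #|U| < adjacent_pairs E H H) ->
  exists2 j, j <= D & 4 * k * #|layer j| < adjacent_pairs E (layer j) (layer j) \/
    k * (#|layer j| + #|layer j.+1|) < adjacent_pairs E (layer j) (layer j.+1).
Proof.
move=> /slow_growth[i iD slow] core.
have ball_neq0 : ball i != set0.
  by apply/set0Pn; exists root; apply: (subsetP (ball_mono (leq0n i))); rewrite inE.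
have := core _ (ball_subset i) ball_neq0.
rewrite (@pairs_self _ _ Esym H (ball i)) ?ball_subset //.
have -> : adjacent_pairs E (ball i) (H :\: ball i) = adjacent_pairs E (layer i) (layer i.+1).
  rewrite -pairs_ball_layer (pairsIDr _ _ (H :\: ball i) (ball i.+1)).
  rewrite [X in _ + X]pairs_no_edge ?addn0.
    congr adjacent_pairs; apply/setP => v; rewrite !inE.
    by case: (v \in ball i) (v \in H) => [] [].
  move=> u v ui /setDP[/setDP[vH _] v1]; apply: contraNF v1 => uv.
  by apply: ball_edges ui vH uv _.
move=> dense.
have [/existsP[j /orP hj]|] := boolP [exists j : 'I_D.+1,
    (4 * k * #|layer j| < adjacent_pairs E (layer j) (layer j)) ||
    (k * (#|layer j| + #|layer j.+1|) < adjacent_pairs E (layer j) (layer j.+1))].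
  by exists j; rewrite // -ltnS.
rewrite negb_exists => /forallP sparse.
(* The reserve [2 * (k * #|layer j|)] pays for the share of [layer j] in the edges to the next
   layer. *)
have bound j : j <= D ->
    adjacent_pairs E (ball j) (ball j) + 2 * (k * #|layer j|) <= 8 * (k * #|ball j|).
  elim: j => [|j IHj] jD.
    rewrite /layer /ball cards1 /adjacent_pairs big_set1 /deg_in big_set1 Eirr; lia.
  rewrite pairs_ballS card_ballS.
  have := IHj (ltnW jD).
  have /norP[_] := sparse (Ordinal (ltnW jD : j < D.+1)).
  have /norP[] := sparse (Ordinal (jD : j.+1 < D.+1)).
  rewrite /= -!leqNgt !mulnDr -!mulnA; lia.
have := bound i.+1 iD; rewrite pairs_ballS; have := leq_mul (leqnn k) slow.
lia.
Qed.

End Layers.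
End DenseSubgraphs.

(** * Short cycles of consecutive even lengths in dense graphs *)

Section TreeCycles.
Variables (V : finType) (E : rel V) (Esym : symmetric E) (Eirr : irreflexive E).
Variables (H : {set V}) (root : V).
Hypothesis rootH : root \in H.
Local Notation layer := (layer E H root).

(** One fixed choice of parents gives a tree: ancestors that have met stay together. *)
Lemma parent_function D : exists pi : V -> V,
  forall v i, i < D -> v \in layer i.+1 -> pi v \in layer i /\ E v (pi v).
Proof.
apply: (@fin_all_exists V (fun=> V)
  (fun v w => forall i, i < D -> v \in layer i.+1 -> w \in layer i /\ E v w)) => v.
have [/existsP[i vi]|no_i] := boolP [exists i : 'I_D, v \in layer i.+1]; last first.
  exists v => i iD vi; case/negP: no_i; apply/existsP; by exists (Ordinal iD).
have [u ui vu] := layer_parent vi; exists u => i' _ vi'.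
by have [->] := layer_inj vi' vi.
Qed.

Variables (pi : V -> V) (D : nat).
Hypothesis piP : forall v i, i < D -> v \in layer i.+1 -> pi v \in layer i /\ E v (pi v).

Lemma iter_parent v j a : j <= D -> a <= j -> v \in layer j -> iter a pi v \in layer (j - a).
Proof.
move=> jD; elim: a => [|a IHa] aj vj; first by rewrite subn0.
have := IHa (ltnW aj) vj; rewrite -(@subnSK a j) // => /piP[] //.
by apply: leq_trans jD; rewrite subnSK // leq_subr.
Qed.

Lemma iter_parent_edge v j a : j <= D -> a < j -> v \in layer j ->
  E (iter a pi v) (iter a.+1 pi v).
Proof.
move=> jD aj vj; have := iter_parent jD (ltnW aj) vj.
rewrite -(@subnSK a j) // => /piP[] //.
by apply: leq_trans jD; rewrite subnSK // leq_subr.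
Qed.

Lemma parent_path v j h : j <= D -> h <= j -> v \in layer j -> path E v (traject pi (pi v) h).
Proof.
move=> jD hj vj; apply/(pathP v) => i; rewrite size_traject => ih.
have -> : nth v (v :: traject pi (pi v) h) i = iter i pi v.
  by rewrite -[v :: _]/(traject pi v h.+1) nth_traject // ltnS ltnW.
rewrite (set_nth_default (pi v)) ?size_traject // nth_traject // -iterSr.
by apply: iter_parent_edge vj; rewrite // (leq_trans ih).
Qed.

(** The two branches first meet at height [h] and add [2 * h - 1] vertices to the [size p + 1] of
    the path; they are disjoint from it because they lie in lower layers. *)
Lemma cycle_through_tree u p j h : j <= D -> 0 < h <= j ->
    path E u p -> uniq (u :: p) -> {subset u :: p <= layer j :|: layer j.+1} ->
    u \in layer j -> last u p \in layer j ->
    iter h pi u = iter h pi (last u p) -> iter h.-1 pi u != iter h.-1 pi (last u p) ->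
  exists c, [/\ graph_cycle E c, size c = size p + 2 * h & {subset c <= H}].
Proof.
move=> jD /andP[h_gt0 hj] pu uu su uj; set v := last u p => vj meet apart.
have p_gt0 : 0 < size p.
  by rewrite lt0n; apply: contraNneq apart => /size0nil p0; rewrite /v p0.
(* [A] climbs from [v] and includes the meeting vertex; [B] descends towards [u] and omits it. *)
pose A := traject pi (pi v) h; pose B := rev (traject pi (pi u) h.-1).
have inA a : a \in A -> exists2 i, i < h & a = iter i.+1 pi v.
  by case/trajectP=> i ih ->; exists i; rewrite // iterSr.
have inB b : b \in B -> exists2 i, i < h.-1 & b = iter i.+1 pi u.
  by rewrite mem_rev => /trajectP[i ih ->]; exists i; rewrite // iterSr.
have levA i : i < h -> iter i.+1 pi v \in layer (j - i.+1).
  by move=> ih; apply: iter_parent => //; apply: leq_trans hj.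
have levB i : i < h.-1 -> iter i.+1 pi u \in layer (j - i.+1).
  by move=> ih; apply: iter_parent => //; lia.
have uniq_traj w n : w \in layer j -> n <= j -> uniq (traject pi (pi w) n).
  move=> wj nj; rewrite -[traject _ _ _]/(behead (traject pi w n.+1)).
  suff : uniq (traject pi w n.+1) by rewrite /= => /andP[].
  apply/(uniqP w) => a b; rewrite !inE !size_traject => an bn.
  rewrite !nth_traject // => e; have := @iter_parent w j a jD _ wj; rewrite e.
  move=> /(_ (leq_trans (an : a <= n) nj)) h1.
  have := layer_inj h1 (@iter_parent w j b jD (leq_trans (bn : b <= n) nj) wj); lia.
have subH : {subset layer j :|: layer j.+1 <= H}.
  by move=> x; rewrite inE => /orP[] /(subsetP (layer_ball _ _ _ _)) /(subsetP (ball_subset _ rootH _)).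
exists (u :: p ++ A ++ B); split.
- apply/andP; split.
    by rewrite /= !size_cat size_traject; lia.
  apply/andP; split; last first.
    rewrite -cat_cons cat_uniq uu cat_uniq /A /B rev_uniq !uniq_traj //; last by lia.
    rewrite /= andbT; apply/andP; split.
      rewrite -all_predC; apply/allP => a; rewrite mem_cat /= => aAB.
      apply/negP => /su; rewrite inE.
      have [i ij ai] : exists2 i, i < j & a \in layer (j - i.+1).
        case/orP: aAB => [/inA[i ih ->]|/inB[i ih ->]].
          by exists i; [lia | apply: levA].
        by exists i; [lia | apply: levB].
      by case/orP=> /(layer_inj ai); clear -ij; lia.
    rewrite -all_predC; apply/allP => b /inB[i ih eb] /=.
    apply/negP => /inA[i' ih' e]; rewrite eb in e.
    have := levB i ih; rewrite e => /(layer_inj (levA i' ih')) eij.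
    have eii : i' = i by lia.
    case/eqP: apart; rewrite eii in e.
    have -> : h.-1 = (h.-1 - i.+1) + i.+1 by rewrite subnK.
    by rewrite !iterD e.
  rewrite /= rcons_cat cat_path pu rcons_cat cat_path /=.
  apply/andP; split; first exact: (parent_path jD hj vj).
  rewrite last_traject -meet.
  have := parent_path jD hj uj; rewrite -rev_path.
  rewrite last_traject.
  have -> : belast u (traject pi (pi u) h) = u :: traject pi (pi u) h.-1.
    by rewrite -[h]prednK // trajectSr belast_rcons.
  rewrite rev_cons; apply: sub_path => x y; by rewrite Esym.
- rewrite /= !size_cat size_rev !size_traject; lia.
- move=> x; rewrite -cat_cons mem_cat => /orP[/su/subH //|].
  rewrite mem_cat => /orP[/inA[i ih ->]|/inB[i ih ->]].
    exact: (subsetP (ball_subset _ rootH _)) (subsetP (layer_ball _ _ _ _) _ (levA i ih)).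
  exact: (subsetP (ball_subset _ rootH _)) (subsetP (layer_ball _ _ _ _) _ (levB i ih)).
Qed.

(** Let [h] be the least height at which the ancestors of all vertices of [C] coincide, and colour
    by the ancestor at height [h.-1]. Ends of different colours meet exactly at height [h], so every
    path is prolonged by the same [2 * h]. *)
Lemma cycles_from_layer (P Q : {set V}) j k :
    1 < k -> j <= D -> P \subset layer j -> Q \subset layer j :|: layer j.+1 ->
    [disjoint P & Q] -> k * (#|P| + #|Q|) < adjacent_pairs E P Q ->
  exists2 r, 2 <= r <= j.+1 & forall i, i < k ->
    exists c, [/\ graph_cycle E c, size c = 2 * r + 2 * i & {subset c <= H}].
Proof.
move=> k_gt1 jD sP sQ dPQ dense.
have [Y sY [Y0 degY]] := bipartite_core Esym Eirr dPQ dense.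
have [C sC [C_gt1 paths]] := bichromatic_paths Esym dPQ k_gt1 Y0 degY.
have layer0 v : v \in layer 0 -> v = root by rewrite inE => /eqP.
have Cj v : v \in C -> v \in layer j by move=> /(subsetP sC) /(subsetP sP).
pose merged h := [forall u in C, forall v in C, iter h pi u == iter h pi v].
have mergedP h u v : merged h -> u \in C -> v \in C -> iter h pi u = iter h pi v.
  by move=> /forall_inP hu uC vC; have /forall_inP/(_ v vC)/eqP := hu u uC.
have mj : merged j.
  apply/forall_inP => u uC; apply/forall_inP => v vC; apply/eqP.
  have := iter_parent jD (leqnn j) (Cj u uC); have := iter_parent jD (leqnn j) (Cj v vC).
  by rewrite subnn => /layer0 -> /layer0 ->.
have ex_m : exists h, merged h by exists j.
case: (ex_minnP ex_m) => h mh h_min.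
have h_gt0 : 0 < h.
  rewrite lt0n; apply: contraTneq C_gt1 => h0; rewrite -leqNgt; apply/card_le1_eqP => u v uC vC.
  by have := mergedP _ _ _ mh uC vC; rewrite h0.
have hj : h <= j by apply: h_min.
have /existsP[u0 /existsP[v0 /and3P[u0C v0C uv0]]] : [exists u, exists v,
    [&& u \in C, v \in C & iter h.-1 pi u != iter h.-1 pi v]].
  apply: contraT; rewrite negb_exists => /forallP hn.
  have : h <= h.-1; last by rewrite leqNgt prednK ?leqnn.
  apply: h_min; apply/forall_inP => u uC; apply/forall_inP => v vC.
  by have := hn u; rewrite negb_exists => /forallP/(_ v); rewrite uC vC negbK.
(* The shortest path has length 2, so the shortest cycle has length [2 + 2 * h]. *)
exists h.+1; first by rewrite !ltnS h_gt0.
move=> i ik; pose chi v := iter h.-1 pi v == iter h.-1 pi u0.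
have [|u [p [pu uu sup [uC vC chi_uv] size_p]]] := paths chi i.+1 ik.
  have chi_v0 : chi v0 = false by apply/negbTE; rewrite /chi eq_sym.
  by exists u0, v0; split=> //; rewrite chi_v0 /chi eqxx.
have [||||||||c [c1 c2 c3]] := @cycle_through_tree u p j h jD; rewrite ?h_gt0 ?hj //.
- by apply: sub_path pu => x y /andP[].
- move=> x /sup /(subsetP sY); rewrite in_setU => /orP[/(subsetP sP) xj|/(subsetP sQ) //].
  by rewrite in_setU xj.
- exact: Cj.
- exact: Cj.
- exact: mergedP.
- by apply: contraNneq chi_uv => e; rewrite /chi e.
by exists c; split=> //; rewrite c2 size_p -!mulnDr [i.+1 + h]addnC addSnnS.
Qed.

End TreeCycles.

Section DenseConsecutive.
Variables (V : finType) (E : rel V) (Esym : symmetric E) (Eirr : irreflexive E).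

(* The exponential growth rate 9/8 of breadth-first balls is what makes the
   cycles logarithmically short. *)
Lemma dense_consecutive_cycles (X : {set V}) k D :
    1 < k -> 8 ^ D * #|V| < 9 ^ D -> 9 * k * #|X| < adjacent_pairs E X X ->
  exists2 r, 2 <= r <= D.+1 & forall i, i < k ->
    exists c, [/\ graph_cycle E c, size c = 2 * r + 2 * i & {subset c <= X}].
Proof.
move=> k_gt1 hD /(dense_core)[H sHX [/set0Pn[root rootH] core]].
have hD' : 8 ^ D * #|H| < 9 ^ D.
  by apply: leq_ltn_trans hD; rewrite leq_mul2l max_card orbT.
have [j jD dense] := dense_layer Esym Eirr rootH hD' core.
have [pi piP] := parent_function E H root D.
(* A dense layer is split by a large cut, at the cost of the factor 4; otherwise two consecutive
   layers are the two sides. *)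
have [P [Q [sP sQ dPQ densePQ]]] : exists P Q : {set V},
    [/\ P \subset layer E H root j, Q \subset layer E H root j :|: layer E H root j.+1,
        [disjoint P & Q] & k * (#|P| + #|Q|) < adjacent_pairs E P Q].
  case: dense => dense.
    have [P sP cut] := max_cut Esym Eirr (layer E H root j).
    exists P, (layer E H root j :\: P); split=> //.
    - by apply: subset_trans (subsetUl _ _); apply: subsetDl.
    - by rewrite disjoints_subset; apply/subsetP => x; rewrite !inE => ->.
    - have := cardsID P (layer E H root j); rewrite (setIidPr sP); nia.
  exists (layer E H root j), (layer E H root j.+1); split=> //; first exact: subsetUr.
  apply/pred0P => x /=; apply/negP => /andP[xj xj'].
  by have := @layer_inj V E H root x j j.+1 xj xj'; clear; lia.
have [r /andP[r2 rj] hr] := cycles_from_layer Esym Eirr rootH piP k_gt1 jD sP sQ dPQ densePQ.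
exists r; first by rewrite r2 (leq_trans rj).
move=> i ik; have [c [c1 c2 c3]] := hr i ik; exists c; split=> // x /c3.
exact: (subsetP sHX).
Qed.

End DenseConsecutive.

(** * Packing cycles *)

Section Packings.
Variables (V : finType) (E : rel V) (Esym : symmetric E).
Implicit Types (R S T U K Y : {set V}) (l : seq nat).

(* The entries of [l] are half-lengths; [U] may be larger than the union of the cycles. *)
Definition cycle_packing l U := exists c : nat -> seq V,
  (forall j, j \in l -> [/\ graph_cycle E (c j), size (c j) = 2 * j & {subset c j <= U}]) /\
  (forall i j, i \in l -> j \in l -> i != j -> [disjoint c i & c j]).

Lemma cycle_packing0 : cycle_packing [::] set0.
Proof. by exists (fun=> [::]). Qed.

Lemma cycle_packing_cons l U j c : cycle_packing l U -> j \notin l ->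
    graph_cycle E c -> size c = 2 * j -> [disjoint c & U] ->
  cycle_packing (j :: l) (U :|: [set x in c]).
Proof.
move=> [d [d1 d2]] jl cc sc dcU; exists (fun i => if i == j then c else d i).
have dis i : i \in l -> [disjoint c & d i].
  by move=> il; apply: disjointWr dcU; apply/subsetP; case: (d1 i il).
split=> [i|i i'].
  rewrite inE; have [->|ij] /= := eqVneq i j.
    by split=> // x xc; rewrite !inE xc orbT.
  by move=> /d1[? ? sU]; split=> // x /sU; rewrite inE => ->.
rewrite !inE; have [->|ij] /= := eqVneq i j; have [->|ij'] /= := eqVneq i' j => //.
- by move=> _ ? _; apply: dis.
- by move=> ? _ _; rewrite disjoint_sym; apply: dis.
- exact: d2.
Qed.

Lemma cycle_packing_sub l l' U : {subset l <= l'} -> cycle_packing l' U -> cycle_packing l U.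
Proof.
move=> sl [c [c1 c2]]; exists c; split=> [j /sl|i j /sl il /sl]; [exact: c1|exact: c2].
Qed.

Lemma packing_consecutive r k l U : 2 <= r -> {subset iota r k <= l} -> cycle_packing l U ->
  exists C : 'I_k -> seq V,
    [/\ forall i : 'I_k, graph_cycle E (C i), vertex_disjoint C & consecutive_even_lengths C].
Proof.
move=> r2 sl [c [c1 c2]].
have inl (i : 'I_k) : r + i \in l by apply: sl; rewrite mem_iota leq_addr ltn_add2l ltn_ord.
exists (fun i => c (r + i)); split.
- by move=> i; have [] := c1 _ (inl i).
- by move=> i j ij; apply: c2 => //; rewrite eqn_add2l.
- by exists r => // i; have [_ -> _] := c1 _ (inl i); rewrite mulnDr.
Qed.

Lemma card_set_seq (c : seq V) : #|[set x in c]| <= size c.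
Proof. by rewrite cardsE card_size. Qed.

(** Cycles are chosen greedily by increasing length; when this gets stuck, the vertices used so far
    meet every cycle of the missing length. *)
Lemma packing_or_hitting_set r k : (exists U, cycle_packing (iota r k) U) \/
  exists2 S : {set V}, #|S| <= k * (2 * (r + k)) & exists2 m, m < k &
    forall c, graph_cycle E c -> size c = 2 * r + 2 * m -> ~ {subset c <= ~: S}.
Proof.
have main m : m <= k ->
  (exists2 U : {set V}, #|U| <= m * (2 * (r + k)) & cycle_packing (iota r m) U) \/
  exists2 S : {set V}, #|S| <= k * (2 * (r + k)) & exists2 m, m < k &
  forall c, graph_cycle E c -> size c = 2 * r + 2 * m -> ~ {subset c <= ~: S}.
  elim: m => [|m IHm] mk; first by left; exists set0; [rewrite cards0|apply: cycle_packing0].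
  have [[U cU pU]|] := IHm (ltnW mk); last by right.
  have [/existsP[c /andP[gc cS]]|no_c] :=
      boolP [exists c : (2 * (r + m)).-tuple V, graph_cycle E c && all (mem (~: U)) c].
    left; exists (U :|: [set x in c]).
      apply: leq_trans (leq_card_setU _ _) _; have : #|[set x in c]| <= 2 * (r + m).
        by apply: leq_trans (card_set_seq c) _; rewrite size_tuple.
      rewrite (mulSnr m) => h; apply: leq_add => //; apply: leq_trans h _.
      by rewrite leq_mul2l leq_add2l ltnW.
    rewrite -addn1 iotaD /= cats1; apply: (@cycle_packing_sub _ (r + m :: iota r m)).
      by move=> x; rewrite mem_rcons.
    apply: cycle_packing_cons => //; first by rewrite mem_iota; lia.
      by rewrite size_tuple.
    rewrite disjoint_subset; apply/subsetP => x xc; have := allP cS x xc.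
    by rewrite /= !inE.
  right; exists U; first by apply: leq_trans cU _; rewrite leq_mul2r (ltnW mk) orbT.
  exists m => // c gc sc sub; case/negP: no_c; apply/existsP.
  have sc' : size c == 2 * (r + m) by rewrite sc mulnDr.
  by exists (Tuple sc'); rewrite /= gc; apply/allP.
by have [[U _ pU]|] := main k (leqnn k); [left; exists U|right].
Qed.

(** The hitting sets for all short starting lengths are united, so each window of [k] even lengths
    has a length missing outside [S]. *)
Lemma hitting_set_all (k R : nat) : (exists r U, 2 <= r /\ cycle_packing (iota r k) U) \/
  exists2 S : {set V}, #|S| <= R.+1 * (k * (2 * (R + k))) & forall r, 2 <= r <= R -> exists2 m, m < k &
    forall c, graph_cycle E c -> size c = 2 * r + 2 * m -> ~ {subset c <= ~: S}.
Proof.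
have main n : n <= R.+1 -> (exists r U, 2 <= r /\ cycle_packing (iota r k) U) \/
  exists2 S : {set V}, #|S| <= n * (k * (2 * (R + k))) & forall r, 2 <= r < n -> exists2 m, m < k &
    forall c, graph_cycle E c -> size c = 2 * r + 2 * m -> ~ {subset c <= ~: S}.
  elim: n => [|n IHn] nR; first by right; exists set0; rewrite ?cards0 // => r; rewrite ltn0 andbF.
  have [|[S cS hS]] := IHn (ltnW nR); first by left.
  have [n1|n2] := ltnP n 2.
    right; exists S; first by rewrite mulSnr; apply: leq_trans cS (leq_addr _ _).
    by move=> r /andP[r2]; rewrite ltnS => rn; have := leq_trans r2 rn; rewrite leqNgt n1.
  have [[U pU]|[S' cS' [m mk hm]]] := packing_or_hitting_set n k; first by left; exists n, U.
  right; exists (S :|: S').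
    apply: leq_trans (leq_card_setU _ _) _; rewrite mulSnr leq_add //.
    by apply: leq_trans cS' _; rewrite !leq_mul2l leq_add2r (nR : n <= R) !orbT.
  move=> r /andP[r2]; rewrite ltnS leq_eqVlt => /orP[/eqP ->|rn].
    exists m => // c gc sc sub; apply: (hm c gc sc) => x /sub.
    by rewrite !inE negb_or => /andP[].
  have [|m' mk' hm'] := hS r; first by rewrite r2.
  exists m' => // c gc sc sub; apply: (hm' c gc sc) => x /sub.
  by rewrite !inE negb_or => /andP[].
have [|[S cS hS]] := main R.+1 (leqnn _); [by left|right; exists S => // r].
Qed.

Fixpoint interleave (s t : seq V) : seq V :=
  if s is x :: s' then if t is y :: t' then [:: x, y & interleave s' t'] else [::] else [::].

Lemma interleave_perm s t : size s = size t -> perm_eq (interleave s t) (s ++ t).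
Proof.
elim: s t => [|x s IHs] [|y t] //= [/IHs h].
by rewrite perm_cons perm_sym (perm_catCA s [:: y] t) perm_cons perm_sym.
Qed.

Lemma interleave_path s t x y : (forall a b, a \in x :: s -> b \in y :: t -> E a b) ->
  path E y (rcons (interleave s t) x).
Proof.
elim: s t y => [|a s IHs] [|b t] y h /=; try by rewrite Esym h // mem_head.
rewrite Esym !h ?inE ?eqxx ?orbT //=; apply: IHs => a' b' ha hb; apply: h.
  by move: ha; rewrite !inE => /orP[] ->; rewrite ?orbT.
by rewrite inE hb orbT.
Qed.

Lemma alternating_cycle s t : uniq s -> uniq t -> size s = size t -> 2 <= size s ->
    (forall a b, a \in s -> b \in t -> E a b) -> (forall a, a \in s -> a \notin t) ->
  exists2 c, graph_cycle E c & size c = 2 * size s /\ c =i s ++ t.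
Proof.
move=> us ut st s2 adj dis; have perm := interleave_perm st.
exists (interleave s t); last first.
  split; last exact: perm_mem perm.
  by rewrite (perm_size perm) size_cat -st; lia.
apply/andP; split; first by rewrite (perm_size perm) size_cat -st; lia.
rewrite /ucycleb (perm_uniq perm) cat_uniq us ut andbT andTb; apply/andP; split; last first.
  by rewrite -all_predC; apply/allP => b bt /=; apply: contraL bt; apply: dis.
case: s t st adj {us ut s2 dis perm} => [|x s] [|y t] //= _ adj.
rewrite adj ?mem_head //=; exact: interleave_path.
Qed.

Definition common_neighbours S T : {set V} := [set v in ~: S | [forall s in T, E s v]].

Lemma extend_packing_in S T0 l0 l1 U : T0 \subset S -> uniq (l1 ++ l0) -> all (leq 2) l1 ->
    cycle_packing l0 U -> sumn l1 <= #|T0 :\: U| ->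
    #|U| + 2 * sumn l1 <= #|common_neighbours S T0| ->
  exists U', [/\ cycle_packing (l1 ++ l0) U', #|U'| <= #|U| + 2 * sumn l1 &
    #|U' :&: S| <= #|U :&: S| + sumn l1].
Proof.
move=> sT; elim: l1 l0 U => [|j l1 IHl] l0 U.
  by move=> _ _ pU _ _; exists U; rewrite !addn0.
rewrite /= => /andP[jl ul] /andP[j2 l2] pU cT cN.
have [s [us ss sT0]] : exists s, [/\ uniq s, size s = j & {subset s <= T0 :\: U}].
  by apply/card_geqP; lia.
have [t [ut st tT0]] : exists s, [/\ uniq s, size s = j & {subset s <= common_neighbours S T0 :\: U}].
  apply/card_geqP; have := cardsID U (common_neighbours S T0).
  have := subset_leq_card (subsetIr (common_neighbours S T0) U); lia.
have dS x : x \in s -> x \notin t.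
  move=> /sT0 /setDP[/(subsetP sT) xS _]; apply/negP => /tT0 /setDP[].
  by rewrite !inE xS.
have adj a b : a \in s -> b \in t -> E a b.
  move=> /sT0 /setDP[aT _] /tT0 /setDP[]; rewrite inE => /andP[_ /forall_inP h] _.
  exact: h.
have st_size : size s = size t by rewrite ss st.
have s_size : 2 <= size s by rewrite ss.
have [c gc [sc cst]] := alternating_cycle us ut st_size s_size adj dS.
have dcU : [disjoint c & U].
  rewrite disjoint_subset; apply/subsetP => x; rewrite cst mem_cat => /orP[/sT0|/tT0];
    by move=> /setDP[_]; rewrite !inE.
have jl0 : j \notin l0 by move: jl; rewrite mem_cat negb_or => /andP[].
have scj : size c = 2 * j by rewrite sc ss.
have cS : #|[set x in c] :&: S| <= j.
  rewrite -ss; apply: leq_trans (card_set_seq s); apply: subset_leq_card.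
  apply/subsetP => x; rewrite !inE cst mem_cat => /andP[/orP[//|/tT0]].
  by rewrite !inE => /andP[_ /andP[/negPf ->]].
have cU' : #|U :|: [set x in c]| <= #|U| + 2 * j.
  rewrite -scj; have := card_set_seq c.
  have : #|U :|: [set x in c]| <= #|U| + #|[set x in c]| := leq_card_setU _ _.
  lia.
have cU'S : #|(U :|: [set x in c]) :&: S| <= #|U :&: S| + j.
  rewrite setIUl; apply: leq_trans (leq_card_setU _ _) _; by rewrite leq_add2l.
have [|||U' [pU' cU1 cU2]] :=
    IHl (j :: l0) (U :|: [set x in c]) _ l2 (cycle_packing_cons pU jl0 gc scj dcU).
- by rewrite -cat1s uniq_catCA cat1s cons_uniq jl.
- have := cardsID [set x in c] (T0 :\: U).
  have <- : T0 :\: (U :|: [set x in c]) = (T0 :\: U) :\: [set x in c] by rewrite setDDl.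
  have : #|(T0 :\: U) :&: [set x in c]| <= j.
    apply: leq_trans cS; apply: subset_leq_card; rewrite setIC; apply: setIS.
    by apply: subset_trans sT; apply: subsetDl.
  clear -cT; lia.
- apply: leq_trans cN; clear -cU'; lia.
exists U'; split; [|clear -cU1 cU'; lia|clear -cU2 cU'S; lia].
apply: cycle_packing_sub pU' => x.
by rewrite !inE !mem_cat inE; case: (x == j) (x \in l1) (x \in l0) => [] [] [].
Qed.

Definition path_between Y R m u p :=
  [/\ path E u p, uniq (u :: p), size p = m, {subset u :: p <= R} & u \in Y /\ last u p \in Y].

(** The cycle runs from [s] along the first path to [s'] and back along the second one reversed. *)
Lemma double_path_cycle (s s' : V) u p u' p' m :
    path E u p -> uniq (u :: p) -> size p = m ->
    path E u' p' -> uniq (u' :: p') -> size p' = m ->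
    [disjoint u :: p & u' :: p'] -> s != s' ->
    (forall x, x \in [:: s; s'] -> x \notin u :: p /\ x \notin u' :: p') ->
    E s u -> E s u' -> E s' (last u p) -> E s' (last u' p') ->
  exists c, [/\ graph_cycle E c, size c = 2 * (m + 2) &
    c =i [:: s; s'] ++ (u :: p) ++ (u' :: p')].
Proof.
move=> pu uu sp pu' uu' sp' dis ss' out su su' s'u s'u'.
exists (s :: (u :: p) ++ s' :: rev (u' :: p')).
have perm : perm_eq (s :: (u :: p) ++ s' :: rev (u' :: p')) ([:: s; s'] ++ (u :: p) ++ (u' :: p')).
  rewrite perm_cons -cat1s perm_sym (perm_catCA [:: s'] (u :: p) _) perm_cat2l.
  by rewrite perm_cons perm_sym perm_rev.
have sz : size (s :: (u :: p) ++ s' :: rev (u' :: p')) = 2 * (m + 2).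
  by rewrite (perm_size perm) !size_cat /= sp sp'; lia.
split=> //; last exact: perm_mem perm.
apply/andP; split; first by rewrite sz; lia.
rewrite /ucycleb (perm_uniq perm); apply/andP; split.
  have back : path E s (rcons (u' :: p') s') by rewrite rcons_path /= su' pu' Esym.
  rewrite /= su rcons_cat cat_path pu /= Esym s'u /=.
  move: back; rewrite -rev_path last_rcons belast_rcons rev_cons.
  by apply: sub_path => x y; rewrite Esym.
rewrite cat_uniq cat_uniq uu uu' andbT; apply/and3P; split.
- by rewrite /= inE ss'.
- rewrite -all_predC; apply/allP => x; rewrite mem_cat /= => xp.
  apply/negP => /out[/negPf h1 /negPf h2]; by rewrite h1 h2 in xp.
- rewrite andTb -all_predC; apply/allP => x xp' /=; apply/negP => xp.
  by have := disjointFr dis xp; rewrite xp'.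
Qed.

End Packings.

(** * Cycles through two deleted vertices *)

Section ConnectingCycles.
Variables (V : finType) (E : rel V) (Esym : symmetric E).
Implicit Types (R S T U K Y : {set V}).

Lemma fresh_neighbour y K U d : #|U| < d -> d <= deg_in E y K ->
  exists s, [/\ s \in K, E s y & s \notin U].
Proof.
rewrite deg_inE => Ud dK.
have : 0 < #|[set x in K | E y x] :\: U|.
  have := cardsID U [set x in K | E y x].
  have := subset_leq_card (subsetIr [set x in K | E y x] U); lia.
by case/card_gt0P=> s; rewrite !inE Esym => /andP[sU /andP[sK ys]]; exists s.
Qed.

(* Record for each chosen path a pair of elements of [K] adjacent to its two ends:
   among [q ^ 2 + 1] disjoint paths two have the same pair. *)
Lemma connecting_cycle S K Y U (m rho k q : nat) :
    K \subset S -> #|K| <= q -> (forall y, y \in Y -> 2 * k <= deg_in E y K) ->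
    #|U :&: S| + 2 <= 2 * k -> #|U| + (q ^ 2).+1 * m.+1 <= rho ->
    (forall R, #|R| <= rho -> exists u p, path_between E Y (~: S :\: R) m u p) ->
  exists c, [/\ graph_cycle E c, size c = 2 * (m + 2), [disjoint c & U] &
    #|[set x in c] :&: S| <= 2].
Proof.
move=> sKS Kq degY US Urho paths.
pose joined (a : V * V) R := exists u p,
  [/\ path_between E Y (~: S :\: U) m u p, {subset u :: p <= R}, a.1 != a.2,
      a.1 \notin U /\ a.2 \notin U & E a.1 u /\ E a.2 (last u p)].
(* [A] holds the pairs recorded so far and [R] the vertices spent; [n] decreases to 0, where [A]
   would have more elements than [setX K K]. *)
suff main n (A : {set V * V}) R : q ^ 2 < #|A| + n -> A \subset setX K K -> U \subset R ->
    #|R| <= #|U| + #|A| * m.+1 -> (forall a, a \in A -> joined a R) ->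
  exists c, [/\ graph_cycle E c, size c = 2 * (m + 2), [disjoint c & U] &
    #|[set x in c] :&: S| <= 2].
  apply: (main (q ^ 2).+1 set0 U); rewrite ?cards0 ?sub0set //; first by rewrite mul0n addn0.
  by move=> a; rewrite inE.
elim: n A R => [|n IHn] A R An sA sUR cR realized.
  have := subset_leq_card sA; rewrite cardsX => h.
  have := leq_mul Kq Kq; rewrite mulnn; lia.
have Aq : #|A| <= q ^ 2.
  by apply: leq_trans (subset_leq_card sA) _; rewrite cardsX -mulnn leq_mul.
have [|u [p [pu uu sp subp [uY vY]]]] := paths R.
  apply: leq_trans cR _; apply: leq_trans Urho; rewrite leq_add2l leq_mul2r orbC.
  by rewrite (leq_trans Aq).
have offU x : x \in u :: p -> x \in ~: S :\: U.
  move=> /subp /setDP[xS xR]; apply/setDP; split=> //.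
  by apply: contra xR; apply: (subsetP sUR).
have [|s [sK su sU]] := @fresh_neighbour u K (U :&: S) (2 * k) _ (degY u uY); first by clear -US; lia.
have [|s' [s'K s'v s'U]] := @fresh_neighbour (last u p) K (s |: (U :&: S)) (2 * k) _ (degY _ vY).
  by rewrite cardsU1; apply: leq_trans US; rewrite addn2 !ltnS -add1n leq_add2r leq_b1.
have inU x : x \in K -> x \notin U :&: S -> x \notin U.
  by move=> /(subsetP sKS) xS; rewrite inE xS andbT.
have ss' : s != s' by apply: contraNneq s'U => ->; rewrite !inE eqxx.
have s'U' : s' \notin U.
  by apply: inU => //; apply: contra s'U => s'U; rewrite inE s'U orbT.
have {}sU := inU s sK sU.
(* A repeated pair supplies a second path with the same attachments, disjoint from the new one
   because the latter avoids [R]. *)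
have [old|new] := boolP ((s, s') \in A).
  have [u' [p' [[pu' uu' sp' sub' [_ _]] subR _ _ [/= su' s'v']]]] := realized _ old.
  have offK x y : x \in K -> y \in ~: S -> x != y.
    by move=> /(subsetP sKS) xS; rewrite inE; apply: contraNneq => <-.
  have [c [gc sc cE]] : exists c, [/\ graph_cycle E c, size c = 2 * (m + 2) &
      c =i [:: s; s'] ++ (u :: p) ++ (u' :: p')].
    apply: double_path_cycle => //.
    - rewrite disjoint_subset; apply/subsetP => x /subp /setDP[_ xR].
      by apply: contra xR => /subR.
    - move=> x x_ss'; have xK : x \in K by move: x_ss'; rewrite !inE => /orP[] /eqP ->.
      by split; apply/negP; [move/offU|move/sub'] => /setDP[xS _]; have := offK x x xK xS; rewrite eqxx.
  exists c; split=> //.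
    rewrite disjoint_subset; apply/subsetP => x; rewrite cE !mem_cat inE => /or3P[|/offU|/sub'].
    + by rewrite !inE => /orP[] /eqP ->.
    + by move=> /setDP[].
    + by move=> /setDP[].
  apply: leq_trans (_ : #|[set s; s']| <= 2); last by rewrite cards2 ss'.
  apply: subset_leq_card; apply/subsetP => x; rewrite !inE cE !mem_cat => /andP[/or3P[|/offU|/sub']].
  + by rewrite !inE.
  + by move=> /setDP[]; rewrite inE => /negPf ->.
  + by move=> /setDP[]; rewrite inE => /negPf ->.
apply: (IHn ((s, s') |: A) (R :|: [set x in u :: p])).
- by rewrite cardsU1 new; clear -An; lia.
- by rewrite subUset sub1set inE sK s'K.
- exact: subset_trans sUR (subsetUl _ _).
- rewrite cardsU1 new mulnDl mul1n.
  apply: leq_trans (leq_card_setU _ _) _.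
  have := card_set_seq (u :: p); rewrite [size _]/= sp; clear -cR; lia.
- move=> a; rewrite !inE => /predU1P[->|/realized[u' [p' [h1 h2 h3 h4 h5]]]].
    have bt : path_between E Y (~: S :\: U) m u p by [].
    exists u, p; split=> //.
    by move=> x xp; rewrite inE [x \in [set _ in _]]inE xp orbT.
  by exists u', p'; split=> // x /h2; rewrite inE => ->.
Qed.

End ConnectingCycles.

(** * Paths in dense graphs *)

Section DensePaths.
Variables (V : finType) (E : rel V) (Esym : symmetric E) (Eirr : irreflexive E).
Implicit Types (A B R S T U W X Y : {set V}).

(** After peeling to minimum degree at least [m], the first vertex of an unextendable path has [m]
    neighbours on it, so the path is long enough to be cut to length [m]. *)
Lemma dense_path X m : 0 < m -> 2 * (m.-1 * #|X|) < adjacent_pairs E X X ->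
  exists u p, path_between E X X m u p.
Proof.
move=> m_gt0 dense; have [|Y sY [Y0 degY]] := @peel _ _ Esym Eirr X (fun=> m.-1).
  by rewrite sum_nat_const mulnC -mulnA [#|X| * _]mulnC in dense *; lia.
have [x [p [px ux sx maxp]]] := unextendable_path Esym Y0.
have m_p : m <= size p.
  have := degY x (sx x (mem_head _ _)); rewrite prednK // deg_inE => h.
  apply: leq_trans h _; apply: leq_trans (card_set_seq p); apply: subset_leq_card.
  apply/subsetP => y; rewrite !inE => /andP[yY xy]; have := maxp y yY xy.
  by rewrite inE => /predU1P[yx|//]; rewrite yx Eirr in xy.
have sub : {subset x :: take m p <= X}.
  move=> y; rewrite inE => y_p; apply: (subsetP sY); apply: sx; rewrite inE.
  by case/orP: y_p => [->//|/mem_take ->]; rewrite orbT.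
exists x, (take m p); split=> //.
- exact: take_path.
- rewrite /= in ux *; case/andP: ux => xp up; rewrite take_uniq // andbT.
  by apply: contra xp; apply: mem_take.
- by rewrite size_take; case: ltngtP m_p.
- by split; apply: sub; rewrite ?mem_head ?mem_last.
Qed.

(** A growing path has one vertex more in [A] than in [B]: an end in [A] must avoid at most [i]
    vertices of [B], and a new vertex of [B] at most [i.+1] of [A]. These are the weights for
    [peel]. *)
Lemma alternating_path A B i : [disjoint A & B] ->
    i * #|A| + i.+1 * #|B| < adjacent_pairs E A B ->
  exists u p, path_between E A (A :|: B) (2 * i.+1) u p.
Proof.
move=> dAB dense; set e := bipartite_rel E A B.
have e_irr : irreflexive e by move=> x; rewrite /e /bipartite_rel /= Eirr.
have e_sym : symmetric e := bipartite_relC Esym A B.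
have ABA : (A :|: B) :\: A = B.
  apply/setP => x; rewrite !inE; case xA: (x \in A) => //=.
  by rewrite (disjointFr dAB xA).
pose w x := if x \in A then i else i.+1.
have [|Y sY [Y0 degY]] := @peel _ e e_sym e_irr (A :|: B) w.
  rewrite (@pairs_self _ _ e_sym (A :|: B) A) ?subsetUl // ABA.
  have -> : adjacent_pairs e A B = adjacent_pairs E A B.
    apply: eq_bigr => x xA; apply: eq_bigr => y yB.
    by rewrite /e /bipartite_rel /= xA yB /= andbT.
  rewrite (big_setID A) /= ABA (setIidPr (subsetUl _ _)).
  have -> : \sum_(x in A) w x = i * #|A|.
    by rewrite mulnC -sum_nat_const; apply: eq_bigr => x xA; rewrite /w xA.
  have -> : \sum_(x in B) w x = i.+1 * #|B|.
    by rewrite mulnC -sum_nat_const; apply: eq_bigr => x xB; rewrite /w (disjointFl dAB).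
  lia.
have eA x y : e x y -> x \in A -> y \in B.
  by rewrite /e /bipartite_rel /= => /andP[_ /orP[/andP[]//|/andP[xB _]]] /(disjointFr dAB); rewrite xB.
have eB x y : e x y -> x \in B -> y \in A.
  by rewrite /e /bipartite_rel /= => /andP[_ /orP[/andP[xA _]|/andP[]//]] /(disjointFl dAB); rewrite xA.
have fresh x W (C : {set V}) : (forall y, e x y -> y \in C) -> #|W :&: C| < deg_in e x Y ->
    exists y, [/\ y \in Y, e x y & y \notin W].
  rewrite deg_inE => sC lt_W.
  have [sub|/subsetPn[y]] := boolP ([set y in Y | e x y] \subset W :&: C); last first.
    rewrite !inE => /andP[yY xy]; rewrite (sC y xy) andbT => yW; by exists y.
  by have := subset_leq_card sub; rewrite leqNgt lt_W.
have [u0 u0Y u0A] : exists2 u, u \in Y & u \in A.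
  have /set0Pn[x xY] := Y0; have [xA|xA] := boolP (x \in A); first by exists x.
  have xB : x \in B by have := subsetP sY x xY; rewrite inE (negPf xA).
  have /deg_in_gt0[y yY xy] : 0 < deg_in e x Y by apply: leq_ltn_trans (degY x xY).
  by exists y => //; apply: eB xy xB.
suff main j : j <= i.+1 -> exists u p, [/\ path_between e A (A :|: B) (2 * j) u p,
    {subset u :: p <= Y}, #|[set x in u :: p] :&: A| <= j.+1 & #|[set x in u :: p] :&: B| <= j].
  have [u [p [[pu uu sp sub ends] _ _ _]]] := main i.+1 (leqnn _).
  by exists u, p; split=> //; apply: sub_path pu => x y /andP[].
elim: j => [|j IHj] ji.
  exists u0, [::]; split.
  - by split=> //= x; rewrite !inE => /eqP ->; rewrite u0A.
  - by move=> x; rewrite inE => /eqP ->.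
  - by apply: leq_trans (subset_leq_card (subsetIl _ _)) (card_set_seq _).
  - rewrite leqn0 cards_eq0 -subset0; apply/subsetP => x; rewrite !inE => /andP[/eqP ->].
    by rewrite (disjointFr dAB u0A).
have [u [p [[pu uu sp sub [uA vA]] sY' cA cB]]] := IHj (ltnW ji).
have uY : u \in Y by apply: sY'; rewrite mem_head.
have [z [zY uz zp]] : exists z, [/\ z \in Y, e u z & z \notin [set x in u :: p]].
  apply: (fresh u _ B) => [y uy|]; first exact: eA uy uA.
  by have := degY u uY; rewrite /w uA => h; apply: leq_ltn_trans cB (leq_ltn_trans (ji : j <= i) h).
have zB := eA _ _ uz uA; have zA := disjointFl dAB zB.
have [y [yY zy yp]] : exists y, [/\ y \in Y, e z y & y \notin [set x in u :: p]].
  apply: (fresh z _ A) => [y zy|]; first exact: eB zy zB.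
  by have := degY z zY; rewrite /w zA => h; apply: leq_ltn_trans cA (leq_ltn_trans ji h).
have yA := eB _ _ zy zB; have yB := disjointFr dAB yA.
rewrite inE in zp; rewrite inE in yp.
exists y, (z :: u :: p); split.
- split.
  + by rewrite /= e_sym zy e_sym uz.
  + rewrite cons_uniq inE negb_or yp cons_uniq zp uu !andbT.
    by apply: contraFneq yB => ->.
  + by rewrite /= sp mulnS.
  + by move=> x; rewrite inE => /predU1P[->|]; [rewrite inE yA|rewrite inE => /predU1P[->|/sub//]; rewrite inE zB orbT].
  + by split.
- by move=> x; rewrite inE => /predU1P[->//|]; rewrite inE => /predU1P[->//|/sY'].
- have -> : [set x in [:: y, z, u & p]] :&: A = y |: ([set x in u :: p] :&: A).
    apply/setP => x; rewrite !inE; have [->|_] /= := eqVneq x y; first by rewrite yA.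
    by have [->|_] //= := eqVneq x z; rewrite zA !andbF.
  by rewrite cardsU1; apply: leq_add (leq_b1 _) cA.
- have -> : [set x in [:: y, z, u & p]] :&: B = z |: ([set x in u :: p] :&: B).
    apply/setP => x; rewrite !inE; have [->|_] /= := eqVneq x z; first by rewrite zB orbT.
    by have [->|_] //= := eqVneq x y; rewrite yB !andbF.
  by rewrite cardsU1; apply: leq_add (leq_b1 _) cB.
Qed.

Variables (G : {set V}) (D : nat).
Hypothesis deg_le : forall v, v \in G -> deg_in E v G <= D.

Lemma pairs_setD X R : X \subset G ->
  adjacent_pairs E X X <= adjacent_pairs E (X :\: R) (X :\: R) + 2 * (#|R| * D).
Proof.
move=> sX; rewrite (@pairs_self _ _ Esym X (X :&: R)) ?subsetIl //.
have -> : X :\: (X :&: R) = X :\: R by rewrite setDIr setDv set0U.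
have bound A : A \subset X -> adjacent_pairs E A X <= #|A| * D.
  move=> sA; apply: pairs_le => x xA; apply: leq_trans (deg_in_subset _ _ sX) _.
  by apply: deg_le; apply: (subsetP sX); apply: (subsetP sA).
have := bound (X :&: R) (subsetIl _ _).
rewrite (pairsIDr _ _ X (X :&: R)) (setIidPr (subsetIl _ _)).
have -> : X :\: (X :&: R) = X :\: R by rewrite setDIr setDv set0U.
have : #|X :&: R| * D <= #|R| * D by rewrite leq_mul2r subset_leq_card ?subsetIr ?orbT.
lia.
Qed.

(** Disjointness puts each deleted vertex on at most one side, which saves the factor 2 of
    [pairs_setD]. *)
Lemma pairs_setD2 A B R : A \subset G -> B \subset G -> [disjoint A & B] ->
  adjacent_pairs E A B <= adjacent_pairs E (A :\: R) (B :\: R) + #|R| * D.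
Proof.
move=> sA sB dAB.
have bound X Y : X \subset G -> Y \subset G -> adjacent_pairs E X Y <= #|X| * D.
  move=> sX sY; apply: pairs_le => x xX; apply: leq_trans (deg_in_subset _ _ sY) _.
  by apply: deg_le; apply: (subsetP sX).
rewrite (pairsIDl _ A B R) (pairsIDr _ (A :\: R) B R) (pairsC Esym (A :\: R) (B :&: R)).
have := bound (A :&: R) B (subset_trans (subsetIl _ _) sA) sB.
have := bound (B :&: R) (A :\: R) (subset_trans (subsetIl _ _) sB) (subset_trans (subsetDl _ _) sA).
have : (#|A :&: R| + #|B :&: R|) * D <= #|R| * D.
  rewrite leq_mul2r; apply/orP; right.
  have : [disjoint A :&: R & B :&: R].
    by apply: disjointWl (subsetIl _ _) _; apply: disjointWr (subsetIl _ _) _.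
  rewrite -leq_card_setU => /eqP <-; apply: subset_leq_card.
  by rewrite subUset !subsetIr.
rewrite mulnDl; lia.
Qed.

End DensePaths.

(** * Popular sets *)

Lemma sumn_iota a n : 2 * sumn (iota a n) + n = n * (2 * a + n).
Proof.
elim: n a => // n IHn a /=; have := IHn a.+1.
rewrite !mulnDr !mulSn !mulnS !mulnDr; lia.
Qed.

Lemma card_bigcup_le (I V : finType) (P : pred I) (F : I -> {set V}) d :
  (forall i, P i -> #|F i| <= d) -> #|\bigcup_(i | P i) F i| <= #|[set i | P i]| * d.
Proof.
move=> Fd; rewrite cardsE -sum_nat_const.
apply: (big_ind2 (fun (A : {set V}) n => #|A| <= n)); rewrite ?cards0 //.
move=> A a B b hA hB; by apply: leq_trans (leq_card_setU _ _) _; apply: leq_add.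
Qed.

Lemma card_small_subsets (V : finType) (S : {set V}) q :
  #|[set T : {set V} | (T \subset S) && (#|T| <= q)]| <= #|S|.+1 ^ q.
Proof.
elim: q => [|q IHq].
  rewrite expn0 -(cards1 (set0 : {set V})); apply: subset_leq_card; apply/subsetP => T.
  by rewrite !inE leqn0 cards_eq0 => /andP[].
set F := [set _ | _] in IHq; set F' := [set _ | _].
have sub : F' \subset F :|: [set x.1 |: x.2 | x in setX S F].
  apply/subsetP => T; rewrite !inE => /andP[TS Tq].
  have [Tq'|Tq'] := leqP #|T| q; first by rewrite TS.
  have /set0Pn[x xT] : T != set0 by rewrite -card_gt0; apply: leq_ltn_trans Tq'.
  rewrite andbF orFb; apply/imsetP; exists (x, T :\ x); last by rewrite /= setD1K.
  rewrite !inE (subsetP TS) //= (subset_trans (subsetDl _ _) TS) /=.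
  by rewrite (cardsD1 x) xT in Tq.
apply: leq_trans (subset_leq_card sub) _; apply: leq_trans (leq_card_setU _ _) _.
have := leq_imset_card (fun x : V * {set V} => x.1 |: x.2) (setX S F).
rewrite cardsX expnS mulSn => h; apply: leq_add => //.
by apply: leq_trans h _; rewrite leq_mul2l IHq orbT.
Qed.

Section PopularSets.
Variables (V : finType) (E : rel V) (Esym : symmetric E).
Variables (S : {set V}) (k q : nat).
Hypotheses (k_ge : 19 <= k) (q2 : 2 * q = k * (k + 3)).
Implicit Types (T U K Y R : {set V}).
Local Notation cnb := (common_neighbours E S).

(** The threshold exceeds [2 * q], the number of vertices on all the cycles of lengths 4 to
    [2 * k + 2], so common neighbours never run out. *)
Definition popular T := (T \subset S) && (4 * k ^ 2 <= #|cnb T|).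

(** These can be neglected: there are few sets of at most [q] elements, and each unpopular one has
    few common neighbours. *)
Definition rare_vertices : {set V} :=
  \bigcup_(T : {set V} | [&& T \subset S, #|T| <= q & ~~ popular T]) cnb T.

Lemma card_rare_vertices : #|rare_vertices| <= #|S|.+1 ^ q * (4 * k ^ 2).
Proof.
apply: leq_trans (@card_bigcup_le _ _ _ _ (4 * k ^ 2) _) _.
  by move=> T /and3P[TS _]; rewrite /popular TS /= -ltnNge => /ltnW.
rewrite leq_mul2r; apply/orP; right; apply: leq_trans (card_small_subsets S q).
by apply: subset_leq_card; apply/subsetP => T; rewrite !inE => /and3P[-> ->].
Qed.

Lemma sumn_iota2 : sumn (iota 2 k) = q.
Proof. have := sumn_iota 2 k; move: q2; rewrite !mulnDr; lia. Qed.

Lemma q_le : q <= k ^ 2.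
Proof. by rewrite -mulnn; have := leq_mul (leqnn k) (ltnW (ltnW k_ge)); nia. Qed.

(* If each popular set sticks out of the vertices used so far by more than [k], a
   longer cycle always fits; so a stuck greedy packing exhibits a core [K]. *)
Lemma popular_core : (exists U, cycle_packing E (iota 2 k) U) \/
  exists2 K : {set V}, K \subset S & #|K| <= q /\ forall T, popular T -> #|T :\: K| <= k.
Proof.
suff main m : m <= k -> (exists U, [/\ cycle_packing E (iota 2 m) U,
    #|U| <= 2 * sumn (iota 2 m) & #|U :&: S| <= sumn (iota 2 m)]) \/
  exists2 K : {set V}, K \subset S & #|K| <= q /\ forall T, popular T -> #|T :\: K| <= k.
  by have [[U [pU _ _]]|] := main k (leqnn k); [left; exists U|right].
elim: m => [|m IHm] mk.
  by left; exists set0; rewrite set0I cards0; split=> //; apply: cycle_packing0.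
have [[U [pU cU cUS]]|] := IHm (ltnW mk); last by right.
have sumS : sumn (iota 2 m.+1) = sumn (iota 2 m) + (m + 2).
  by rewrite -[m.+1]addn1 iotaD sumn_cat /= addn0 [2 + m]addnC.
have sum_q : sumn (iota 2 m) + (m + 2) <= q.
  by rewrite -sumn_iota2 -{1}(subnKC mk) iotaD sumn_cat sumS leq_addr.
(* More than [k] free vertices of [T] suffice for the next cycle, of half-length [m + 2 <= k.+1].
   Without such a [T] the used part of [S] is the core. *)
have [/existsP[T /andP[popT bigT]]|none] :=
    boolP [exists T : {set V}, popular T && (k < #|T :\: (U :&: S)|)]; last first.
  right; exists (U :&: S); first exact: subsetIr.
  split=> [|T popT]; first by apply: leq_trans cUS _; apply: leq_trans sum_q; apply: leq_addr.
  by rewrite leqNgt; apply: contra none => bigT; apply/existsP; exists T; rewrite popT.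
case/andP: popT => TS cT.
have TU : T :\: (U :&: S) = T :\: U.
  apply/setP => x; rewrite !inE; case xT: (x \in T); rewrite ?andbF // !andbT.
  by rewrite (subsetP TS x xT) andbT.
have [||||U' [pU' cU' cU'S]] := @extend_packing_in _ E Esym S T (iota 2 m) [:: m + 2] U TS _ _ pU.
- by rewrite cat1s cons_uniq iota_uniq andbT mem_iota addnC ltnn andbF.
- by rewrite /= andbT leq_addl.
- by rewrite /= addn0 -TU; apply: leq_trans bigT; rewrite addn2.
- apply: leq_trans cT; rewrite /= addn0; have := q_le; move: cU sum_q; lia.
left; exists U'; split.
- apply: cycle_packing_sub pU' => j; rewrite mem_iota => /andP[j2 jm].
  rewrite cat1s in_cons mem_iota j2 /= [m + 2]addnC -leq_eqVlt; by rewrite addnS in jm.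
- rewrite sumS mulnDr; move: cU'; rewrite /= addn0; clear -cU; lia.
- rewrite sumS; move: cU'S; rewrite /= addn0; clear -cUS; lia.
Qed.

(** The half-lengths outside [l0] add up to [q - sumn l0], and [U] blocks at most [#|U :&: S|]
    vertices of [T0]. *)
Lemma packing_of_popular T0 l0 U : popular T0 -> uniq l0 -> {subset l0 <= iota 2 k} ->
    cycle_packing E l0 U -> #|U| <= 2 * sumn l0 ->
    q <= #|T0| + sumn l0 - #|U :&: S| ->
  exists U', cycle_packing E (iota 2 k) U'.
Proof.
move=> /andP[TS cT] u0 s0 pU cU qT.
pose l1 := [seq j <- iota 2 k | j \notin l0].
have ul : uniq (l1 ++ l0).
  rewrite cat_uniq u0 filter_uniq ?iota_uniq // andbT andTb -all_predC; apply/allP => j jl0 /=.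
  by rewrite mem_filter jl0.
have mem_l : l1 ++ l0 =i iota 2 k.
  move=> j; rewrite mem_cat mem_filter; case jl: (j \in l0); rewrite ?orbF ?orbT //.
  by rewrite (s0 j).
have sum_l : sumn l1 + sumn l0 = q.
  rewrite -sumn_iota2 -sumn_cat; apply: perm_sumn.
  by apply: uniq_perm => //; apply: iota_uniq.
have [|||U' [pU' _ _]] := @extend_packing_in _ E Esym S T0 l0 l1 U TS ul _ pU.
- by apply/allP => j; rewrite mem_filter mem_iota => /and3P[].
- have := cardsID U T0; have : #|T0 :&: U| <= #|U :&: S|.
    by apply: subset_leq_card; rewrite setIC; apply: setIS.
  lia.
- apply: leq_trans cT; have := q_le; lia.
by exists U'; apply: cycle_packing_sub pU' => j; rewrite mem_l.
Qed.

(* A path of length [m] yields a cycle of half-length [m + 2] that costs two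
   vertices of [S] instead of [m + 2]. *)
Lemma packing_of_paths T0 K Y (ms : seq nat) : popular T0 -> K \subset S -> #|K| <= q ->
    (forall y, y \in Y -> 2 * k <= deg_in E y K) ->
    uniq ms -> (forall m, m \in ms -> 0 < m < k) -> size ms < k ->
    q <= #|T0| + sumn ms ->
    (forall m R, m \in ms -> #|R| <= 2 * k ^ 5 ->
      exists u p, path_between E Y (~: S :\: R) m u p) ->
  exists U, cycle_packing E (iota 2 k) U.
Proof.
move=> popT sK Kq degY u_ms ms_k size_ms q_ms paths.
have sum_ms l : {subset l <= ms} -> sumn (map (addn 2) l) <= size l * k.+1 /\
    sumn (map (addn 2) l) = sumn l + 2 * size l.
  elim: l => //= m l IHl sl; have [|h1 h2] := IHl.
    by move=> x xl; apply: sl; rewrite inE xl orbT.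
  have := ms_k m (sl m (mem_head _ _)); rewrite mulSn; clear -h1 h2; lia.
suff main l : {subset l <= ms} -> uniq l -> size l < k ->
    exists U, [/\ cycle_packing E (map (addn 2) l) U, #|U| <= 2 * sumn (map (addn 2) l) &
      #|U :&: S| <= 2 * size l].
  have [U [pU cU cUS]] := main ms (fun _ => id) u_ms size_ms.
  have [_ e] := sum_ms ms (fun _ => id).
  apply: (packing_of_popular popT _ _ pU cU).
  - by rewrite map_inj_uniq // => x y; apply: addnI.
  - move=> j /mapP[m /ms_k /andP[m0 mk] ->]; rewrite mem_iota; clear -m0 mk; lia.
  - rewrite e; clear -q_ms cUS; lia.
elim: l => [|m l IHl] sl ul lk.
  by exists set0; rewrite set0I cards0; split=> //; apply: cycle_packing0.
have sl' : {subset l <= ms} by move=> x xl; apply: sl; rewrite inE xl orbT.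
case/andP: ul => ml ul.
have [U [pU cU cUS]] := IHl sl' ul (ltnW lk).
have m_ms : m \in ms by apply: sl; rewrite mem_head.
have /andP[m_gt0 m_k] := ms_k m m_ms.
(* By [q <= k ^ 2] the recorded paths take at most [k ^ 5 + k] vertices, and the earlier cycles only
   quadratically many in [k]. *)
have Urho : #|U| + (q ^ 2).+1 * m.+1 <= 2 * k ^ 5.
  have [h _] := sum_ms l sl'.
  have h1 : (q ^ 2).+1 * m.+1 <= k ^ 5 + k.
    by rewrite [k ^ 5]expnSr -mulSnr; apply: leq_mul => //; rewrite ltnS -[4]/(2 * 2) expnM leq_exp2r // q_le.
  have h2 : size l * k.+1 <= k * k.+1 by rewrite leq_mul2r (ltnW (ltnW lk)) orbT.
  have h3 : 2 * (k * k.+1) + k <= k ^ 5.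
    rewrite !expnS expn0 muln1; have := leq_mul (leqnn k) k_ge.
    have := leq_mul (leq_mul k_ge k_ge) (leqnn (k * k)).
    have := leq_mul (leqnn (k * k * (k * k))) k_ge; rewrite mulnS !mulnA; lia.
  clear -h h1 h2 h3 cU; lia.
have [||c [gc sc dc cS]] := connecting_cycle Esym sK Kq degY _ Urho.
- by move: lk cUS; rewrite /=; clear; lia.
- by move=> R cR; apply: paths.
exists (U :|: [set x in c]); split.
- apply: cycle_packing_cons => //; last by rewrite sc addnC.
  by rewrite mem_map //; apply: addnI.
- apply: leq_trans (leq_card_setU _ _) _; rewrite /= mulnDr addnC; apply: leq_add => //.
  by apply: leq_trans (card_set_seq c) _; rewrite sc addnC.
- rewrite setIUl; apply: leq_trans (leq_card_setU _ _) _; rewrite /= mulnS addnC.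
  exact: leq_add.
Qed.

End PopularSets.

(** * Edge counting outside the deleted set *)

(** To be used with [y] and [z] the sizes of [Y] and [Zg], [w] a bound for the rare vertices, [e]
    the edges from [Y] to [B :\: Y], and [r] the edges lost with a forbidden set. The conclusion is
    the density required by [alternating_path]. *)
Lemma alternating_slack i k y z w r e d :
    i * i.+1 < d -> 2 * i.+1 < k -> (2 * d + 1) * y <= 4 * e ->
    (7 * k + 1) * z <= 2 * e + 9 * (k * w) -> 20 * (k * w) <= y -> 20 * r <= y -> 0 < y ->
  i * y + i.+1 * (z + w) + r < e.
Proof.
move=> i_d i_k hy hz hw hr y_gt0.
have h1 : 7 * (i * y) <= 4 * e.
  apply: leq_trans hy; rewrite mulnA leq_mul2r; apply/orP; right.
  have i_sq : 5 * i <= 2 * (i * i) + 3.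
    by case: (i) => [|[|j]] //; clear; nia.
  by move: i_d i_sq; rewrite mulnS; clear; lia.
have h2 : 14 * (i.+1 * z) <= 2 * e + 9 * (k * w).
  apply: leq_trans hz; rewrite mulnA leq_mul2r; apply/orP; right; lia.
have h3 : 2 * (i.+1 * w) <= k * w by rewrite mulnA leq_mul2r; apply/orP; right; lia.
have h4 : 3 * y <= 4 * e.
  by apply: leq_trans hy; rewrite leq_mul2r; apply/orP; right; lia.
rewrite mulnDr; lia.
Qed.

(** The lengths [2, 4, ..., 2 * i.+1] add up to [i.+1 * i.+2]; [i] is least such that they cover the
    deficit [d]. *)
Lemma square_between d : 0 < d -> exists2 i, i * i.+1 < d & d <= i.+1 * i.+2.
Proof.
move=> d_gt0; have ex : exists i, d <= i.+1 * i.+2 by exists d; nia.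
case: (ex_minnP ex) => i hi i_min; exists i => //.
case: i hi i_min => [|i] // _ i_min; rewrite ltnNge; apply/negP => /i_min.
by rewrite ltnn.
Qed.

Lemma triangle_bound i k d : 19 <= k -> i * i.+1 < d -> 2 * d + 1 <= 9 * k -> 2 * i.+1 < k.
Proof.
move=> k_ge i_d d_k; rewrite ltnNge; apply/negP => k_i.
have : i * i.+1 <= 9 * i + 8 by lia.
have : 9 <= i by lia.
move: (i) => j j9; rewrite mulnS; have := leq_mul (leqnn j) j9; nia.
Qed.

Lemma sumn_even I : sumn [seq 2 * j | j <- iota 1 I] = I * I.+1.
Proof.
elim: I => // I IHI; rewrite -[I.+1]addn1 iotaD map_cat sumn_cat IHI /= addn0.
rewrite addn1; nia.
Qed.

(** The average degree gives [2 * q + 2] per vertex while the objective charges only [2 * q + 1].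
    The surplus of one per vertex must, up to small errors, come from pairs inside [B], so [B] is
    large. *)
Lemma core_order_bound n b m s w q k F P tot :
    (2 * q + 2) * n <= s ^ 2 + tot -> tot + (2 * q + 1) * b <= 2 * F + P + (2 * q + 1) * m ->
    m <= n -> F <= b * q + w * s -> P <= 9 * k * b -> 2 * (s ^ 2 + 2 * (s * w)) <= n ->
  n <= 18 * (k * b).
Proof.
move=> h1 h2 h3 h4 h5 h6.
have h7 : (2 * q + 1) * m <= (2 * q + 1) * n by rewrite leq_mul2l h3 orbT.
by move: h1 h2 h4 h5 h6 h7; clear; move: (s ^ 2); lia.
Qed.

(** [k >= 19] gives [2 * q >= 22 * k]; subtracting the [6 * k], respectively [15 * k], per vertex on
    the right leaves the two bounds. *)
Lemma low_degree_bounds q k z w b e : 19 <= k -> 2 * q = k * (k + 3) ->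
    (2 * q + 1) * z <= 2 * (3 * k * z) + 9 * k * b ->
    (2 * q + 1) * z <= 2 * (3 * k * z) + 9 * k * (z + w) + 2 * e ->
  16 * z <= 9 * b /\ (7 * k + 1) * z <= 2 * e + 9 * (k * w).
Proof.
move=> k_ge q2; have hq : 22 * k <= 2 * q.
  by rewrite q2 mulnC leq_mul2l addn3 !ltnS k_ge orbT.
have hz : (22 * k + 1) * z <= (2 * q + 1) * z by rewrite leq_mul2r leq_add2r hq orbT.
move=> h1 h2; split.
  have k_gt0 : 0 < k by apply: leq_trans k_ge.
  rewrite -(leq_pmul2l k_gt0).
  move: hz h1; clear; lia.
move: hz h2; clear; lia.
Qed.

Lemma high_degree_bounds n k b w r y z u : 19 <= k -> 0 < n ->
    n <= 18 * (k * b) -> 1000 * (k ^ 3 * w) <= n -> 1000 * (k * r) <= n ->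
    16 * z <= 9 * b -> b <= y + z + u -> u <= w ->
  [/\ 20 * (k * w) <= y, 20 * r <= y, 0 < y & 55 * (k ^ 2 * w) <= b].
Proof.
move=> k_ge n_gt0 h1 h2 h3 h4 h5 h6; have k_gt0 : 0 < k by lia.
have b1 : 1000 * (k ^ 2 * w) <= 18 * b.
  rewrite -(leq_pmul2l k_gt0); move: (leq_trans h2 h1); rewrite expnS -mulnA; lia.
have b2 : 1000 * r <= 18 * b.
  rewrite -(leq_pmul2l k_gt0); move: (leq_trans h3 h1); lia.
have kw : k * w <= k ^ 2 * w by rewrite leq_mul2r leq_pmulr ?orbT // -expnS leq_exp2l.
have w_kw : 19 * w <= k * w by rewrite leq_mul2r k_ge orbT.
have b_gt0 : 0 < b by rewrite lt0n; apply: contraTneq h1 => ->; rewrite !muln0 -ltnNge.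
clear h1 h2 h3; split; lia.
Qed.

(** Non-rare vertices send at most [t = q - d] edges to [S], so optimality demands [2 * d + 1] pairs
    inside [B] for each, whereas sparsity allows about [9 * k]. *)
Lemma deficit_bound t q d k g b w P : 19 <= k -> 2 * q = k * (k + 3) -> q = t + d ->
    (2 * q + 1) * g <= 2 * (g * t) + P -> P <= 9 * k * b -> b <= g + w ->
    55 * (k ^ 2 * w) <= b -> 0 < b ->
  2 * d + 1 <= 9 * k.
Proof.
move=> k_ge q2 qtd h1 h2 h3 h4 b_gt0; rewrite leqNgt; apply/negP => kd.
have h5 : (2 * d + 1) * g <= 9 * k * b.
  apply: leq_trans h2; move: h1; rewrite qtd; clear; lia.
have h6 : (9 * k + 1) * b <= (2 * d + 1) * b by rewrite leq_mul2r addn1 kd orbT.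
have h7 : (2 * d + 1) * b <= (2 * d + 1) * g + (2 * d + 1) * w.
  by rewrite -mulnDr leq_mul2l h3 orbT.
have h8 : (2 * d + 1) * w <= (k * (k + 3) + 1) * w.
  by rewrite leq_mul2r -q2 qtd; apply/orP; right; lia.
have h9 : (k * (k + 3) + 1) * w <= 3 * (k ^ 2 * w).
  rewrite mulnA leq_mul2r -mulnn; apply/orP; right; have := leq_mul (leqnn k) k_ge; lia.
move: h6; rewrite mulnDl mul1n; lia.
Qed.

Lemma deficit_inequality t q d y a b P : q = t + d ->
    (2 * q + 1) * y + b <= 2 * (y * t) + (a + 2 * P + b) ->
  (2 * d + 1) * y <= a + 2 * P.
Proof.
by move=> ->; lia.
Qed.

(** For [M = (d + 2)./2] one has [d <= 2 * M - 1], and [M (M + 1) / 2 >= 2 * M - 1] because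
    [(M - 1) (M - 2) >= 0]. Under the cap [k.-1], use [k (k - 1) / 2 >= 9 * k]. *)
Lemma triangular_deficit k d : 19 <= k -> 2 * d + 1 <= 9 * k ->
  d <= sumn (iota 1 (minn (d + 2)./2 k.-1)).
Proof.
move=> k_ge d_k; have half : d + 2 <= 2 * (d + 2)./2 + 1.
  by rewrite -{1}(odd_double_half (d + 2)) -mul2n addnC leq_add2l leq_b1.
have := sumn_iota 1 (minn (d + 2)./2 k.-1).
case: (leqP (d + 2)./2 k.-1) => [_|_]; move: (sumn _) => s.
  move: half; move: (d + 2)./2 => [|[|M]] h e; [lia|lia|].
  have := leq0n (M * M); move: e; rewrite !mulnDr !mulnS !mulSn; lia.
case: k k_ge d_k => // j; rewrite ltnS /= => j_ge d_j e.
have jj : 18 * j <= j * j by rewrite leq_mul2r j_ge orbT.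
move: jj d_j j_ge e; clear; lia.
Qed.

(** Here [m] is the path length minus one. The surplus [y / 2] in [p] outweighs the loss
    [2 * r <= y / 10]. *)
Lemma dense_slack d m y y' p p' r : 2 * m <= d -> (2 * d + 1) * y <= 2 * p ->
    p <= p' + 2 * r -> 20 * r <= y -> 0 < y -> y' <= y ->
  2 * (m * y') < p'.
Proof.
move=> m_d hp hp' hr y_gt0 y_le.
have h1 : 2 * m * y' <= d * y by apply: leq_mul.
move: h1 hp; rewrite mulnDl -!mulnA; lia.
Qed.

Section OptimalSubset.
Variables (V : finType) (E : rel V) (G : {set V}) (f : V -> nat) (c : nat).

(* The optimised quantity is twice the number of edges meeting [B] minus [c * #|B|],
   with [c * #|G|] added to stay in [nat]. *)
Lemma optimal_subset : exists2 B : {set V}, B \subset G &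
  (forall U : {set V}, U \subset B ->
    c * #|U| + adjacent_pairs E (B :\: U) (B :\: U) <=
    2 * \sum_(x in U) f x + adjacent_pairs E B B) /\
  2 * \sum_(x in G) f x + adjacent_pairs E G G + c * #|B| <=
  2 * \sum_(x in B) f x + adjacent_pairs E B B + c * #|G|.
Proof.
pose g (B : {set V}) := 2 * \sum_(x in B) f x + adjacent_pairs E B B + c * #|G :\: B|.
have [B sB B_max] : exists2 B : {set V}, B \subset G &
    forall X : {set V}, X \subset G -> g X <= g B.
  by case: (@arg_maxnP _ G (fun B : {set V} => B \subset G) g (subxx G)) => B; exists B.
have cG (X : {set V}) : X \subset G -> #|G| = #|X| + #|G :\: X|.
  by move=> sX; rewrite -(cardsID X G) (setIidPr sX).
exists B => //; split=> [U sU|].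
  have := B_max (B :\: U) (subset_trans (subsetDl _ _) sB); rewrite /g /=.
  rewrite (big_setID U (A := B)) (setIidPr sU) /=.
  have := cG _ sB; have := cG _ (subset_trans (subsetDl B U) sB).
  have : #|B| = #|U| + #|B :\: U| by rewrite -(cardsID U B) (setIidPr sU).
  move: #|U| #|B :\: U| #|B| #|G| #|G :\: B| #|G :\: (B :\: U)| => u1 u2 u3 u4 u5 u6 e1 e2 e3.
  have -> : u6 = u5 + u1 by lia.
  rewrite !mulnDr; lia.
have := B_max G (subxx G); rewrite /g /= setDv cards0 (cG B sB) mulnDr muln0; lia.
Qed.

End OptimalSubset.

(** * Packing in a graph that is sparse outside the deleted set *)

Section MainCounting.
Variables (V : finType) (E : rel V) (Esym : symmetric E) (Eirr : irreflexive E).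
Variables (S : {set V}) (k q D : nat).
Implicit Types (B T U K Y Z R X : {set V}).
Hypotheses (k_ge : 19 <= k) (q2 : 2 * q = k * (k + 3)).
Local Notation rare := (rare_vertices E S k q).
Local Notation popular := (popular E S k).
Local Notation w := (#|S|.+1 ^ q * (4 * k ^ 2)).
Hypothesis sparse : forall X, X \subset ~: S -> adjacent_pairs E X X <= 9 * k * #|X|.
Hypothesis deg_le : forall v, v \in ~: S -> deg_in E v (~: S) <= D.
Hypothesis edges : (2 * q + 2) * #|V| <= adjacent_pairs E [set: V] [set: V].
Hypothesis S_small : 2 * (#|S| ^ 2 + 2 * (#|S| * w)) <= #|V|.
Hypothesis w_small : 1000 * (k ^ 3 * w) <= #|V|.
Hypothesis D_small : 1000 * (k * (2 * k ^ 5 * D)) <= #|V|.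

Definition nbhd_in v : {set V} := [set s in S | E v s].

Lemma card_nbhd_in v : #|nbhd_in v| = deg_in E v S.
Proof. by rewrite deg_inE. Qed.

Lemma nbhd_in_popular v T : v \in ~: S -> v \notin rare -> T \subset nbhd_in v -> #|T| <= q ->
  popular T.
Proof.
move=> vS v_rare sT Tq; apply: contraR v_rare => Tpop; apply/bigcupP; exists T.
  rewrite Tq Tpop !andbT; apply: subset_trans sT _; apply/subsetP => s.
  by rewrite inE => /andP[].
rewrite inE vS; apply/forall_inP => s /(subsetP sT); rewrite inE Esym.
by case/andP.
Qed.

(** One neighbour too many would yield a popular set of size [#|T0|.+1 <= q], against maximality. *)
Lemma degree_into_popular T0 v :
    #|T0| < q -> (forall T, popular T -> #|T| <= q -> #|T| <= #|T0|) ->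
    v \in ~: S -> v \notin rare -> deg_in E v S <= #|T0|.
Proof.
move=> T0q T0_max vS v_rare; rewrite leqNgt -card_nbhd_in; apply/negP => /card_geqP[s [us ss sub]].
have cT : #|[set x in s]| = #|T0|.+1 by rewrite cardsE (card_uniqP us).
have sT : [set x in s] \subset nbhd_in v by apply/subsetP => x; rewrite inE => /sub.
have cTq : #|[set x in s]| <= q by rewrite cT.
by have := T0_max _ (nbhd_in_popular vS v_rare sT cTq) cTq; rewrite cT ltnn.
Qed.

(** The whole neighbourhood in [S] is popular, so at most [k] of its elements lie outside [K]. *)
Lemma degree_into_core T0 K v :
    #|T0| < q -> (forall T, popular T -> #|T| <= q -> #|T| <= #|T0|) ->
    K \subset S -> (forall T, popular T -> #|T :\: K| <= k) ->
    v \in ~: S -> v \notin rare -> 3 * k <= deg_in E v S -> 2 * k <= deg_in E v K.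
Proof.
move=> T0q T0_max sK K_core vS v_rare v_deg.
have vq : #|nbhd_in v| <= q.
  by rewrite card_nbhd_in (leq_trans (degree_into_popular T0q T0_max vS v_rare)) // ltnW.
have := K_core _ (nbhd_in_popular vS v_rare (subxx _) vq).
have := cardsID K (nbhd_in v); rewrite card_nbhd_in [deg_in E v K]deg_inE.
have -> : nbhd_in v :&: K = [set y in K | E v y].
  apply/setP => x; rewrite !inE; case xK: (x \in K); rewrite ?andbF // (subsetP sK) //.
  by rewrite andbT.
by move: v_deg; clear; lia.
Qed.

Lemma packing_of_dense_graph : exists U, cycle_packing E (iota 2 k) U.
Proof.
have k_gt0 : 0 < k by apply: leq_trans k_ge.
have q_gt0 : 0 < q by move: q2; clear -k_ge; nia.
have w_ge : #|S| + 4 * k ^ 2 <= w.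
  have h1 : #|S|.+1 * (4 * k ^ 2) <= w.
    by rewrite leq_mul2r -{1}(expn1 #|S|.+1) leq_pexp2l ?orbT.
  apply: leq_trans h1; rewrite (mulSn #|S|) addnC leq_add2l leq_pmulr //.
  by rewrite muln_gt0 expn_gt0 k_gt0.
have V_ge : #|S| + 4 * k ^ 2 <= #|V|.
  have k3 : 0 < k ^ 3 by rewrite expn_gt0 k_gt0.
  apply: leq_trans w_ge _; apply: leq_trans w_small.
  exact: leq_trans (leq_pmull w k3) (leq_pmull _ _).
have V_gt0 : 0 < #|V|.
  by apply: leq_trans V_ge; rewrite addn_gt0 muln_gt0 expn_gt0 k_gt0 orbT.
have pop0 : popular set0.
  rewrite /popular sub0set /=.
  have -> : common_neighbours E S set0 = ~: S.
    apply/setP => v; rewrite !inE; case: (v \in S) => //=.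
    by apply/forall_inP => s; rewrite inE.
  by rewrite -(leq_add2l #|S|) cardsC.
have [T0 [T0pop T0q T0_max]] : exists T0, [/\ popular T0, #|T0| <= q &
    forall T, popular T -> #|T| <= q -> #|T| <= #|T0|].
  have h0 : popular set0 && (#|@set0 V| <= q) by rewrite pop0 cards0.
  case: (@arg_maxnP _ set0 (fun T : {set V} => popular T && (#|T| <= q)) (fun T => #|T|) h0).
  move=> T0 /andP[h1 h2] h3; exists T0; split=> // T T1 T2; apply: h3; by rewrite T1.
have [qT0|T0_lt] := leqP q #|T0|.
  apply: (@packing_of_popular V E Esym S k q k_ge q2 T0 [::] set0) => //.
  - exact: cycle_packing0.
  - by rewrite cards0.
  - by rewrite set0I cards0 addn0 subn0.
have [//|[K sK [Kq K_core]]] := popular_core Esym S k_ge q2.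
pose d := q - #|T0|; have qd : q = #|T0| + d by rewrite subnKC // ltnW.
have d_gt0 : 0 < d by rewrite subn_gt0.
clearbody d.
have [B sB [B_opt B_big]] := optimal_subset E (~: S) (fun v => deg_in E v S) (2 * q + 1).
pose P := adjacent_pairs E.
pose Y := [set v in B | (v \notin rare) && (3 * k <= deg_in E v S)].
(* Vertices of [Zg] send few edges to [S], so optimality makes their degree in [B]
   large: alternating paths between [Y] and [B :\: Y] exist unless [Y] is dense. *)
pose Zg := [set v in B | (v \notin rare) && (deg_in E v S < 3 * k)].
have sYB : Y \subset B by apply/subsetP => v; rewrite inE => /andP[].
have sZB : Zg \subset B by apply/subsetP => v; rewrite inE => /andP[].
have sYS : Y \subset ~: S := subset_trans sYB sB.
have c_rare : #|B :&: rare| <= w.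
  by apply: leq_trans (card_rare_vertices E S k q); apply/subset_leq_card/subsetIr.
have good_deg v : v \in B -> v \notin rare -> deg_in E v S <= #|T0|.
  by move=> vB; apply: degree_into_popular => //; apply: (subsetP sB).
have PB : P B B <= 9 * k * #|B| by apply: sparse.
have sum_le U d' : (forall x, x \in U -> deg_in E x S <= d') ->
    \sum_(x in U) deg_in E x S <= #|U| * d'.
  by move=> h; rewrite -sum_nat_const; apply: leq_sum.
have cB : #|B| <= #|Y| + #|Zg| + #|B :&: rare|.
  rewrite -(cardsID rare B) addnC leq_add2r; apply: leq_trans (leq_card_setU _ _).
  apply/subset_leq_card/subsetP => v /setDP[vB vr]; rewrite !inE vB vr /=.
  by case: leqP.
have n_B : #|V| <= 18 * (k * #|B|).
  apply: core_order_bound B_big _ _ PB S_small.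
  - apply: leq_trans edges _; rewrite (@pairs_self _ _ Esym [set: V] S) ?subsetT // setTD.
    rewrite -addnA leq_add ?(pairsC Esym S) //.
    apply: leq_trans (pairs_le _) _; first by move=> x _; apply: deg_in_le_card.
    by rewrite mulnn.
  - exact: max_card.
  - rewrite (big_setID rare) /= addnC; apply: leq_add.
      apply: leq_trans (sum_le (B :\: rare) q _) _.
        by move=> x /setDP[xB xr]; apply: leq_trans (good_deg x xB xr) T0q.
      by rewrite leq_mul2r subset_leq_card ?subsetDl ?orbT.
    apply: leq_trans (sum_le (B :&: rare) #|S| _) _; first by move=> x _; apply: deg_in_le_card.
    by rewrite leq_mul2r c_rare orbT.
have cZ : #|B :\: Y| <= #|Zg| + w.
  apply: leq_trans (leq_add (leqnn _) c_rare); apply: leq_trans (leq_card_setU _ _).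
  apply/subset_leq_card/subsetP => v /setDP[vB]; rewrite !inE vB /=.
  by case: (v \in rare) => //=; rewrite -ltnNge orbF.
have ZY : P (B :\: Y) (B :\: Y) <= 9 * k * (#|Zg| + w).
  apply: leq_trans (sparse _) _; first by apply: subset_trans (subsetDl _ _) sB.
  by rewrite leq_mul2l cZ orbT.
have PBY : P B B = P Y Y + 2 * P Y (B :\: Y) + P (B :\: Y) (B :\: Y) by apply: pairs_self.
have [z_b z_e] : 16 * #|Zg| <= 9 * #|B| /\
    (7 * k + 1) * #|Zg| <= 2 * P Y (B :\: Y) + 9 * (k * w).
  have Zopt := B_opt Zg sZB.
  have Zdeg : \sum_(x in Zg) deg_in E x S <= 3 * k * #|Zg|.
    rewrite mulnC; apply: sum_le => x; rewrite inE => /and3P[_ _]; exact: ltnW.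
  have YZ : P Y Y <= P (B :\: Zg) (B :\: Zg).
    apply: pairs_subset; apply/subsetP => v; rewrite !inE => /and3P[-> vr v3];
      by rewrite vr ltnNge v3.
  apply: (low_degree_bounds k_ge q2).
  - apply: leq_trans (leq_trans (leq_addr _ _) Zopt) _.
    by apply: leq_add => //; rewrite leq_mul2l Zdeg orbT.
  - move: Zopt Zdeg YZ ZY; rewrite -/(P B B) -/(P _ _) PBY; clear.
    move: (P Y Y) (P Y _) (P _ _) (P _ _) (\sum_(x in _) _) ((2 * q + 1) * _) (3 * k * _) (9 * k * _).
    lia.
have [y_kw y_D y_gt0 b_kw] := high_degree_bounds k_ge V_gt0 n_B w_small D_small z_b cB c_rare.
have b_gt0 : 0 < #|B| by apply: leq_trans y_gt0 (subset_leq_card sYB).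
have d_k : 2 * d + 1 <= 9 * k.
  have sG := subsetDl B rare.
  apply: (@deficit_bound #|T0| q d k #|B :\: rare| #|B| w (P B B)) => //.
  - apply: leq_trans (leq_trans (leq_addr _ _) (B_opt _ sG)) _; rewrite leq_add2r leq_mul2l.
    by apply: sum_le => x /setDP[xB xr]; apply: good_deg.
  - by rewrite -(cardsID rare B) addnC leq_add2l.
(* Removing [Y] from [B] is no improvement, and each vertex of [Y] sends at most [q - d] edges to
   [S]. *)
have YP : (2 * d + 1) * #|Y| <= P Y Y + 2 * P Y (B :\: Y).
  apply: (deficit_inequality qd (b := P (B :\: Y) (B :\: Y))).
  rewrite -PBY; apply: leq_trans (B_opt Y sYB) _; rewrite leq_add2r leq_mul2l.
  by apply: sum_le => x; rewrite inE => /and3P[xB xr _]; apply: good_deg.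
have degY y : y \in Y -> 2 * k <= deg_in E y K.
  rewrite inE => /and3P[yB yr y3].
  by apply: (degree_into_core T0_lt T0_max) => //; apply: (subsetP sB).
have finish ms : uniq ms -> (forall m, m \in ms -> 0 < m < k) -> size ms < k -> d <= sumn ms ->
    (forall m R, m \in ms -> #|R| <= 2 * k ^ 5 ->
      exists u p, path_between E Y (~: S :\: R) m u p) ->
    exists U, cycle_packing E (iota 2 k) U.
  move=> h1 h2 h3 h4 h5.
  apply: (packing_of_paths Esym k_ge q2 T0pop sK Kq degY h1 h2 h3) => //.
  by rewrite qd leq_add2l.
have widen X R m : X \subset B -> (exists u p, path_between E Y (X :\: R) m u p) ->
    exists u p, path_between E Y (~: S :\: R) m u p.
  move=> sX [u' [p' [h1 h2 h3 h4 h5]]]; exists u', p'; split=> // x /h4 /setDP[xX xR].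
  by apply/setDP; split=> //; apply: (subsetP sB); apply: (subsetP sX).
have RD R : #|R| <= 2 * k ^ 5 -> #|R| * D <= 2 * k ^ 5 * D.
  by move=> cR; rewrite leq_mul2r cR orbT.
move: y_D RD; set rD := 2 * k ^ 5 * D => y_D RD; clearbody rD.
(* At least half of the bound [YP] comes from inside [Y], giving paths of all small lengths, or from
   edges leaving [Y], giving alternating paths of even lengths. *)
have [dense|sparseY] := leqP ((2 * d + 1) * #|Y|) (2 * P Y Y).
  apply: (finish (iota 1 (minn (d + 2)./2 k.-1))).
  - exact: iota_uniq.
  - move=> m; rewrite mem_iota add1n ltnS leq_min => /andP[-> /andP[_ m_k]].
    by apply: leq_ltn_trans m_k _; rewrite prednK.
  - rewrite size_iota; apply: leq_ltn_trans (geq_minr _ _) _; by rewrite prednK.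
  - exact: triangular_deficit.
  - move=> m R; rewrite mem_iota add1n ltnS leq_min => /andP[m_gt0 /andP[m_d m_k]] cR.
    have sYR : Y :\: R \subset Y := subsetDl _ _.
    have [|u [p [p1 p2 p3 p4 [p5 p6]]]] := @dense_path _ E Esym Eirr (Y :\: R) m m_gt0.
      apply: (dense_slack _ dense (pairs_setD Esym deg_le R sYS) _ y_gt0).
      + have : 2 * m <= d + 2.
          apply: leq_trans (_ : 2 * (d + 2)./2 <= _); first by rewrite leq_mul2l m_d orbT.
          by rewrite mul2n -{2}(odd_double_half (d + 2)) leq_addl.
        clear -m_gt0; lia.
      + by apply: leq_trans y_D; rewrite leq_mul2l RD // orbT.
      + exact: subset_leq_card.
    apply: (widen Y) => //; exists u, p; split=> //.
    by split; apply: (subsetP sYR).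
have sZS : B :\: Y \subset ~: S by apply: subset_trans (subsetDl _ _) sB.
have dYZ : [disjoint Y & B :\: Y].
  by rewrite disjoint_sym disjoints_subset subsetDr.
have YZ : (2 * d + 1) * #|Y| <= 4 * P Y (B :\: Y).
  by move: YP sparseY; clear; move: (P _ _) (P _ _) (_ * #|Y|); lia.
have [i i_d d_i] := square_between d_gt0.
have i_k := triangle_bound k_ge i_d d_k.
have slack := alternating_slack i_d i_k YZ z_e y_kw y_D y_gt0.
apply: (finish [seq 2 * j | j <- iota 1 i.+1]).
- by rewrite map_inj_uniq ?iota_uniq // => x y /eqP; rewrite eqn_pmul2l // => /eqP.
- move=> m /mapP[j]; rewrite mem_iota add1n ltnS => /andP[j_gt0 j_i] ->.
  rewrite muln_gt0 j_gt0; apply: leq_ltn_trans i_k; by rewrite leq_mul2l j_i.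
- rewrite size_map size_iota; apply: leq_ltn_trans i_k; exact: leq_pmull.
- by rewrite sumn_even.
- move=> m R /mapP[[|j]]; rewrite mem_iota // add1n ltnS => /andP[_ j_i] -> cR.
  have dYZR : [disjoint Y :\: R & (B :\: Y) :\: R].
    by apply: disjointWl (subsetDl _ _) _; apply: disjointWr (subsetDl _ _) _.
  have [|u [p [p1 p2 p3 p4 [p5 p6]]]] := @alternating_path _ E Esym Eirr _ _ j dYZR.
    rewrite -(ltn_add2r (#|R| * D)); apply: leq_trans (pairs_setD2 Esym deg_le R sYS sZS dYZ).
    apply: leq_ltn_trans slack; apply: leq_add; last exact: RD.
    apply: leq_add; apply: leq_mul => //.
      exact/subset_leq_card/subsetDl.
    by apply: leq_trans cZ; apply/subset_leq_card/subsetDl.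
  apply: (widen B) => //; exists u, p; split=> //.
    move=> x /p4; rewrite inE => /orP[] /setDP[xB xR]; apply/setDP; split=> //.
      exact: (subsetP sYB).
    by case/setDP: xB.
  by split; apply: (subsetP (subsetDl Y R)).
Qed.

End MainCounting.

(** * Numerical estimates and conclusion *)

Lemma double_cube_le_exp a : 12 <= a -> 2 * a ^ 3 <= 2 ^ a.
Proof.
move=> /subnK <-; elim: (a - 12) => [|b IHb]; first by rewrite !expnS expn0; lia.
rewrite addSn [2 ^ _.+1]expnS; apply: leq_trans (leq_mul (leqnn 2) IHb).
rewrite leq_mul2l /=; move: (b + 12) (leq_addl b 12) => c c_ge.
have h1 : 12 * (c * c) <= c * c * c by rewrite mulnC leq_mul2l c_ge orbT.
have h2 : 12 * c <= c * c by rewrite leq_mul2r c_ge orbT.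
rewrite !expnS expn0 !muln1; move: h1 h2 c_ge; rewrite !mulnA; clear; nia.
Qed.

(** With [a = N %/ (4 * k ^ 2)], the bound [32 * k ^ 3] gives [a >= 8 * k], whence
    [N <= 2 * a ^ 3 <= 2 ^ a]; raise this to the power [4 * k ^ 2]. *)
Lemma polynomial_le_exp k N : 19 <= k -> 32 * k ^ 3 <= N -> N ^ (4 * k ^ 2) <= 2 ^ N.
Proof.
move=> k_ge N_ge; have k2 : 0 < 4 * k ^ 2 by rewrite muln_gt0 expn_gt0 (leq_trans _ k_ge).
pose a := N %/ (4 * k ^ 2).
have a_ge : 8 * k <= a by rewrite leq_divRL // mulnACA -expnS.
have a12 : 12 <= a by apply: leq_trans a_ge; lia.
have N_a : N <= 2 ^ a.
  apply: leq_trans (double_cube_le_exp a12).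
  have : N < a.+1 * (4 * k ^ 2) by rewrite -ltn_divLR.
  move/ltnW/leq_trans; apply.
  have k_a : 4 * k ^ 2 <= a ^ 2.
    apply: leq_trans (_ : (8 * k) ^ 2 <= _); last by rewrite leq_exp2r.
    by rewrite expnMn leq_mul2r orbT.
  rewrite [a ^ 3]expnS [2 * (a * _)]mulnA; apply: leq_mul => //; move: a12; clear; lia.
apply: leq_trans (_ : (2 ^ a) ^ (4 * k ^ 2) <= _).
  by rewrite leq_exp2r.
by rewrite -expnM leq_exp2l // leq_trunc_div.
Qed.

(** Six levels account for a doubling, as [8 ^ 6 * 2 <= 9 ^ 6]. *)
Lemma breadth_first_depth n N : n < 2 ^ N.+1 -> 8 ^ (6 * N.+1) * n < 9 ^ (6 * N.+1).
Proof.
move=> n_lt; apply: leq_trans (_ : 8 ^ (6 * N.+1) * 2 ^ N.+1 <= _).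
  by rewrite ltn_pmul2l ?expn_gt0.
have base : 8 ^ 6 * 2 <= 9 ^ 6 by rewrite !expnS !expn0; lia.
rewrite !expnM -expnMn (leq_exp2r _ _ (ltn0Sn N)); exact: base.
Qed.

Section Sizes.
Variables (n k q N : nat).
Hypotheses (k_ge : 19 <= k) (q2 : 2 * q = k * (k + 3)).
Hypotheses (N_ge : 32 * k ^ 3 <= N) (n_ge : 2 ^ N <= n).

Lemma log_order_large : 600 * k ^ 2 <= N /\ 1000 * k <= N.
Proof.
have h1 : 600 * k ^ 2 <= N.
  by apply: leq_trans N_ge; rewrite [k ^ 3]expnS mulnA leq_mul2r; apply/orP; right; move: k_ge; clear; lia.
split=> //; apply: leq_trans h1; rewrite expnS expn1.
have := leq_mul (leqnn k) k_ge; clear; lia.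
Qed.

Lemma power_le_order j m : j <= N ^ m -> m <= 4 * k ^ 2 -> j <= n.
Proof.
move=> hj hm; apply: leq_trans hj _; apply: leq_trans n_ge.
apply: leq_trans (polynomial_le_exp k_ge N_ge); apply: leq_pexp2l => //.
by have [_] := log_order_large; move: k_ge; clear; lia.
Qed.

(** Up to factors absorbed by few powers of [N], both sides are [N ^ (4 * q)], and
    [4 * q = 2 * k ^ 2 + 6 * k] stays below [4 * k ^ 2]. *)
Lemma deleted_set_small s : s < N ^ 4 ->
  2 * (s ^ 2 + 2 * (s * (s.+1 ^ q * (4 * k ^ 2)))) <= n /\
  1000 * (k ^ 3 * (s.+1 ^ q * (4 * k ^ 2))) <= n.
Proof.
move=> s_lt; have [N1 N2] := log_order_large.
have N_gt0 : 0 < N by move: N2 k_ge; clear; lia.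
have kk : 19 * k <= k ^ 2 by rewrite -mulnn leq_mul2r k_ge orbT.
have exponent : 4 * q.+1 + 1 <= 4 * k ^ 2.
  move: q2 kk k_ge; rewrite mulnDr mulnn; clear; lia.
have q_gt0 : 0 < q by move: q2 k_ge; clear; nia.
have pow j : s.+1 ^ j <= N ^ (4 * j) by rewrite expnM; case: j => // j; rewrite leq_exp2r.
split.
  apply: (@power_le_order _ (4 * q.+1 + 1)) => //.
  apply: leq_trans (_ : N * s.+1 ^ q.+1 <= _); last by rewrite addn1 [N ^ _.+1]expnS leq_mul2l pow orbT.
  have h1 : s ^ 2 <= s.+1 ^ q.+1.
    by apply: leq_trans (_ : s.+1 ^ 2 <= _); [rewrite leq_exp2r | apply: leq_pexp2l].
  have h2 : s * (s.+1 ^ q * (4 * k ^ 2)) <= 4 * k ^ 2 * s.+1 ^ q.+1.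
    by rewrite [s.+1 ^ q * _]mulnC mulnCA [s.+1 ^ q.+1]expnS leq_mul2l leq_mul2r leqnSn !orbT.
  have h3 : (16 * k ^ 2 + 2) * s.+1 ^ q.+1 <= N * s.+1 ^ q.+1.
    rewrite leq_mul2r; apply/orP; right; move: N1 kk k_ge; clear; lia.
  move: h1 h2 h3; clear; move: (s * _) (s ^ 2) (s.+1 ^ _) => A B C; rewrite mulnDl -!mulnA.
  move: (k ^ 2 * C); lia.
apply: (@power_le_order _ (4 * q + 2)); last first.
  by apply: leq_trans exponent; rewrite mulnS; clear; lia.
rewrite expnD; apply: leq_trans (_ : N ^ 2 * s.+1 ^ q <= _); last first.
  by rewrite mulnC leq_mul2r pow orbT.
have h : 4000 * k ^ 5 <= N ^ 2.
  rewrite -mulnn; apply: leq_trans (leq_mul N1 N_ge).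
  rewrite mulnACA -expnD leq_mul2r; apply/orP; right; clear; lia.
apply: leq_trans (_ : 4000 * k ^ 5 * s.+1 ^ q <= _); last by rewrite leq_mul2r h orbT.
rewrite (expnD k 3 2); move: (s.+1 ^ q) (k ^ 3) (k ^ 2) => A B C; clear; lia.
Qed.

Lemma deleted_set_bound s h : s <= (6 * N.+1).+2 * (k * (2 * ((6 * N.+1).+1 + k))) ->
  h <= 18 * 1000 * k ^ 7 -> s + h < N ^ 4.
Proof.
move=> hs hh; have [N1 N2] := log_order_large.
have s_le : s <= N ^ 3.
  apply: leq_trans hs _; rewrite [N ^ 3]expnS -mulnn.
  apply: leq_trans (_ : 7 * N * (k * (14 * N)) <= _).
    apply: leq_mul; first by move: N2 k_ge; clear; lia.
    by rewrite leq_mul2l; apply/orP; right; move: N2 k_ge; clear; lia.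
  apply: leq_trans (_ : 98 * k * (N * N) <= _); first by clear; lia.
  by rewrite leq_mul2r; apply/orP; right; move: N2; clear; lia.
have h_le : h <= N ^ 3.
  apply: leq_trans hh _; apply: leq_trans (_ : (32 * k ^ 3) ^ 3 <= _); last by rewrite leq_exp2r.
  rewrite expnMn -expnM; apply: leq_mul; first by rewrite !expnS expn0; clear; lia.
  by apply: leq_pexp2l => //; apply: leq_trans k_ge.
rewrite [N ^ 4]expnS; apply: leq_trans (_ : 3 * N ^ 3 <= _).
  have : 0 < N ^ 3 by rewrite expn_gt0; move: N2 k_ge; clear; lia.
  move: s_le h_le; clear; lia.
by rewrite leq_mul2r; move: N2 k_ge; clear; lia.
Qed.

End Sizes.

Lemma avg_degree_pairs (V : finType) (E : rel V) d : 0 < #|V| ->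
  (d%:R <= avg_degree E)%R -> d * #|V| <= adjacent_pairs E [set: V] [set: V].
Proof.
move=> V_gt0; rewrite /avg_degree.
have -> : \sum_(x : V) degree E x = adjacent_pairs E [set: V] [set: V].
  rewrite /adjacent_pairs; apply: eq_big => [x|x _]; first by rewrite inE.
  by rewrite deg_inE /degree; apply: eq_card => y; rewrite !inE.
rewrite ler_pdivlMr ?ltr0n // -natrM ler_nat.
by [].
Qed.

Theorem theorem1p2 (k : nat) (hk : 19 <= k)
    (V : finType) (E : rel V) (Esym : symmetric E) (Eirr : irreflexive E)
    (order_ge : 2 ^ (32 * k ^ 3) <= #|V|)
    (avg_ge : (((k + 2) * (k + 1))%N%:R <= avg_degree E)%R) :
  exists C : 'I_k -> seq V,
    [/\ forall i : 'I_k, graph_cycle E (C i),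
        vertex_disjoint C
      & consecutive_even_lengths C].
Proof.
have V_gt0 : 0 < #|V| by apply: leq_trans order_ge; rewrite expn_gt0.
pose N := trunc_log 2 #|V|.
have N_ge : 32 * k ^ 3 <= N by apply: trunc_log_max.
have /andP[n_ge n_lt] : 2 ^ N <= #|V| < 2 ^ N.+1 by apply: trunc_log_bounds.
clearbody N.
have [q q2] : exists q, 2 * q = k * (k + 3).
  exists (k * (k + 3))./2; rewrite mul2n halfK.
  by rewrite [odd _]oddM oddD; case: (odd k); rewrite /= subn0.
have k_gt0 : 0 < k by apply: leq_trans hk.
have edges := avg_degree_pairs V_gt0 avg_ge.
(* Breadth-first depth [6 * N.+1] produces starting half-lengths up to its successor, so these are
   the ones to hit. *)
have [[r [U [r2 pU]]]|[S0 cS0 hit]] := hitting_set_all E k (6 * N.+1).+1.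
  exact: packing_consecutive r2 (fun _ => id) pU.
have sparse0 (X : {set V}) : X \subset ~: S0 -> adjacent_pairs E X X <= 9 * k * #|X|.
  move=> sX; rewrite leqNgt; apply/negP => dense.
  have [r r_le cyc] := dense_consecutive_cycles Esym Eirr (leq_trans (isT : 1 < 19) hk)
    (breadth_first_depth n_lt) dense.
  have [m mk no_cycle] := hit r r_le.
  have [c [gc sc cX]] := cyc m mk.
  by apply: (no_cycle c gc sc) => x /cX; apply: (subsetP sX).
(* Deleting [2 * k ^ 5] vertices of degree at most [D] then loses at most [#|V| / (1000 * k)] edges,
   while sparsity still leaves only polynomially many hubs in [k]. *)
pose D := #|V| %/ (2 * 1000 * k ^ 6).
have k6 : 0 < 2 * 1000 * k ^ 6 by rewrite muln_gt0 expn_gt0 k_gt0.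
pose hubs := [set v in ~: S0 | D < deg_in E v (~: S0)].
have c_hubs : #|hubs| <= 18 * 1000 * k ^ 7.
  have : #|hubs| * D.+1 <= 9 * k * #|V|.
    apply: leq_trans (_ : adjacent_pairs E hubs (~: S0) <= _).
      by apply: pairs_ge => v; rewrite inE => /andP[].
    apply: leq_trans (pairs_subset _ _ (subxx _)) (leq_trans (sparse0 _ (subxx _)) _).
      by apply/subsetP => v; rewrite inE => /andP[].
    by rewrite leq_mul2l max_card orbT.
  have : #|V| <= D.+1 * (2 * 1000 * k ^ 6) by apply/ltnW; rewrite -ltn_divLR.
  move=> h1 h2; rewrite -(leq_pmul2r (ltn0Sn D)); apply: leq_trans h2 _.
  apply: leq_trans (leq_mul (leqnn (9 * k)) h1) _.
  by rewrite [k ^ 7]expnS; lia.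
pose S := S0 :|: hubs.
have S_lt : #|S| < N ^ 4.
  apply: leq_ltn_trans (leq_card_setU _ _) _.
  exact: (deleted_set_bound hk N_ge cS0 c_hubs).
have sS : ~: S \subset ~: S0 by rewrite setCS subsetUl.
have [S_small w_small] := deleted_set_small hk q2 N_ge n_ge S_lt.
have [U pU] : exists U, cycle_packing E (iota 2 k) U.
  apply: (packing_of_dense_graph (S := S) (D := D) Esym Eirr hk q2) => //.
  - by move=> X sX; apply: sparse0; apply: subset_trans sS.
  - move=> v vS; apply: leq_trans (deg_in_subset _ _ sS) _; rewrite leqNgt.
    move: vS; rewrite in_setC in_setU negb_or => /andP[vS0 v_hub]; apply: contra v_hub => v_deg.
    by rewrite inE in_setC vS0.
  - apply: leq_trans edges; rewrite leq_mul2r; apply/orP; right; rewrite q2; clear; lia.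
  - apply: leq_trans (leq_trunc_div #|V| (2 * 1000 * k ^ 6)); rewrite -/D [k ^ 6]expnS; lia.
exact: packing_consecutive (leqnn 2) (fun _ => id) pU.
Qed.
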